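(* Let $G$ be a deterministic $d$-regular graph on $n$ vertices, let $\lambda_2$ be the second largest eigenvalue of $\frac1dA_G$ and $\lambda_n$ its smallest eigenvalue, and assume $\lambda_2<1$. Let $\varepsilon\in(0,1/2)$ and $\delta>0$. If $$\frac{d}{\log n}\ \ge\ 4\frac{1+|\lambda_n|}{(1-\lambda_2)^2}(1+\delta)\left[\frac{1}{(1-2\varepsilon)^2}+\frac13\frac{1-\lambda_2}{(1-2\varepsilon)(1+|\lambda_n|)}+\frac13\frac{1-\lambda_2}{1+|\lambda_n|}-1\right],$$ then with probability at least $1-n^{-\delta}$ the semidefinite program $\max\operatorname{Tr}(WX)$ s.t. $X\succeq0$, $X_{ii}=1\ \forall i$, has $gg^T$ as its unique optimal solution, where $g_i=(-1)^{x_i}$. As $\varepsilon\to1/2$ the condition can be written $\frac{d}{\log n}\ge4\frac{1+|\lambda_n|}{(1-\lambda_2)^2}(1+\delta)\left[\frac{1}{(1-2\varepsilon)^2}+o\!\left(\frac{1}{(1-2\varepsilon)^2}\right)\right]$, and if moreover $\lambda_2=o(1)$ and $|\lambda_n|=o(1)$ it reads $\frac{d}{\log n}\ge\frac{4(1+\delta)}{(1-2\varepsilon)^2}+o\!\left(\frac{1}{(1-2\varepsilon)^2}\right)$.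
   Context: Model: $G=(V,E)$, $V=[n]$, with adjacency matrix $A_G$; unknown $x\in\{0,1\}^n$; for each edge $(i,j)$ one observes $Y_{(i,j)}=x_i\oplus x_j\oplus Z_{(i,j)}$ (mod 2) with $Z_{(i,j)}$ i.i.d. Bernoulli$(\varepsilon)$. $W\in\mathbb{R}^{n\times n}$ has $W(i,j)=(-1)^{Y_{(i,j)}}$ if $(i,j)\in E$ and $0$ otherwise. Equivalently $\lambda_2=\frac1d\max_{x\perp\mathbf 1}\frac{x^TA_Gx}{x^Tx}$ and $|\lambda_n|=\frac1d\max_{x\perp\mathbf 1}\left(-\frac{x^TA_Gx}{x^Tx}\right)$. Logarithms are natural. *)

(* Defs.v *)
From Stdlib Require Import Reals List Arith Lia ClassicalEpsilon.
Import ListNotations.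
Open Scope R_scope.

Fixpoint rsum (n : nat) (f : nat -> R) : R :=
  match n with O => 0 | S k => rsum k f + f k end.

Definition simple_regular (n d : nat) (a : nat -> nat -> bool) : Prop :=
  (forall i j, a i j = a j i) /\
  (forall i, a i i = false) /\
  (forall i j, a i j = true -> (i < n)%nat /\ (j < n)%nat) /\
  (forall i, (i < n)%nat -> length (filter (fun j => a i j) (seq 0 n)) = d).

Definition adjR (a : nat -> nat -> bool) (i j : nat) : R := if a i j then 1 else 0.

Definition quad (n : nat) (M : nat -> nat -> R) (v : nat -> R) : R :=
  rsum n (fun i => rsum n (fun j => v i * M i j * v j)).

Definition sqnorm (n : nat) (v : nat -> R) : R := rsum n (fun i => v i * v i).

Definition rayleigh_set (n d : nat) (a : nat -> nat -> bool) (r : R) : Prop :=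
  exists v : nat -> R, rsum n v = 0 /\ sqnorm n v <> 0 /\
    r = / INR d * (quad n (adjR a) v / sqnorm n v).

Definition IsMax (S : R -> Prop) (m : R) : Prop := S m /\ forall y, S y -> y <= m.

Definition is_lambda2 (n d : nat) (a : nat -> nat -> bool) (l : R) : Prop :=
  IsMax (rayleigh_set n d a) l.

Definition is_abs_lambdan (n d : nat) (a : nat -> nat -> bool) (l : R) : Prop :=
  IsMax (fun r => rayleigh_set n d a (- r)) l.

Definition edges (n : nat) (a : nat -> nat -> bool) : list (nat * nat) :=
  filter (fun p => andb (Nat.ltb (fst p) (snd p)) (a (fst p) (snd p)))
         (list_prod (seq 0 n) (seq 0 n)).

(* W(i,j) = (-1)^{Y_(i,j)} for edges, 0 otherwise, where
   Y_(u,v) = x_u xor x_v xor Z_(u,v); zs lists the noise bits Z_e in the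
   order of the edge list E. *)
Definition W_of (E : list (nat * nat)) (x : nat -> bool) (zs : list bool)
  (i j : nat) : R :=
  fold_right
    (fun (pz : (nat * nat) * bool) acc =>
       let '((u, v), z) := pz in
       if orb (andb (Nat.eqb u i) (Nat.eqb v j)) (andb (Nat.eqb u j) (Nat.eqb v i))
       then (if xorb (xorb (x u) (x v)) z then -1 else 1) + acc
       else acc)
    0 (combine E zs).

Fixpoint blists (m : nat) : list (list bool) :=
  match m with
  | O => cons (@nil bool) nil
  | S k => map (cons true) (blists k) ++ map (cons false) (blists k)
  end.

(* probability of a noise pattern under i.i.d. Bernoulli(eps) *)
Definition weight (eps : R) (zs : list bool) : R :=
  fold_right (fun (b : bool) (acc : R) => (if b then eps else 1 - eps) * acc) 1 zs.

Definition prob (n : nat) (a : nat -> nat -> bool) (eps : R)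
  (P : list bool -> Prop) : R :=
  fold_right
    (fun (zs : list bool) (acc : R) =>
       (if excluded_middle_informative (P zs) then weight eps zs else 0) + acc)
    0 (blists (length (edges n a))).

Definition sdp_feasible (n : nat) (X : nat -> nat -> R) : Prop :=
  (forall i j, (i < n)%nat -> (j < n)%nat -> X i j = X j i) /\
  (forall v : nat -> R, 0 <= quad n X v) /\
  (forall i, (i < n)%nat -> X i i = 1).

Definition trace_prod (n : nat) (W X : nat -> nat -> R) : R :=
  rsum n (fun i => rsum n (fun j => W i j * X j i)).

Definition sdp_unique_opt (n : nat) (W X0 : nat -> nat -> R) : Prop :=
  sdp_feasible n X0 /\
  forall X, sdp_feasible n X ->
    trace_prod n W X <= trace_prod n W X0 /\
    (trace_prod n W X = trace_prod n W X0 ->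
       forall i j, (i < n)%nat -> (j < n)%nat -> X i j = X0 i j).

Definition gvec (x : nat -> bool) (i : nat) : R := if x i then -1 else 1.

(* Main.v *)
(** The signed Laplacian [L = sum_e (1 - 2 Z_e) L_e] is the dual certificate: if it is positive
    definite on the orthogonal complement of the constants, a Gram decomposition of a feasible
    point shows that [g g^T] is the unique optimum.  Its failure is controlled by a matrix Bernstein
    bound with the sharp constants.  Since each summand is a random multiple of a fixed rank-one
    projection [u u^T], neither Lieb's theorem nor Golden-Thompson is needed: for
    [f c = sum_(k < K) tr ((M + c u u^T)^k) / k!] with [M] semidefinite, the moments
    [m_k = u^T (M + c u u^T)^k u] satisfy [m_i m_j <= m_(i+j)], whence [f'' <= f'], so [f] is a
    concave function of [exp c].  This pushes the expectation through one edge at a time, truncated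
    at any [K], and only the scalar exponential series is ever passed to the limit. *)

Require Import Defs.
From Stdlib Require Import Reals List Arith Lia Lra Psatz ClassicalEpsilon.
Import ListNotations.
Open Scope R_scope.

(** The moment inequalities hold for a semidefinite matrix perturbed in a nonnegative direction,
    whereas the centered noise [k (Z_e - p)] of an edge takes both signs. So each edge carries
    [k Z_e], and the whole centering sits in a fixed base matrix, made semidefinite by adding a
    multiple [s] of the identity; [s] moves both sides of the final comparison equally and cancels.
    Jensen's inequality in the variable [exp c] replaces each random coefficient by
    [c = ln (1 - p + p exp k)]. Once all edges are averaged, what remains is [s I] plus
    [(c - k p) / 2] times the ordinary Laplacian: [|lambda_n|] enters through the top eigenvalue of
    this matrix, and [lambda_2] through the size that a fluctuation needs in order to destroy
    positivity. Truncated traces are polynomials in [c], so their derivatives are finite sums. *)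

(** * Finite sums *)

Lemma rsum_ext n f g :
  (forall i, (i < n)%nat -> f i = g i) -> rsum n f = rsum n g.
Proof.
  induction n as [|n IH]; simpl; intros H; [reflexivity|].
  rewrite IH, H; auto with arith.
Qed.

Lemma rsum_le n f g :
  (forall i, (i < n)%nat -> f i <= g i) -> rsum n f <= rsum n g.
Proof.
  induction n as [|n IH]; simpl; intros H; [lra|].
  apply Rplus_le_compat; auto with arith.
Qed.

Lemma rsum_plus n f g : rsum n (fun i => f i + g i) = rsum n f + rsum n g.
Proof. induction n as [|n IH]; simpl; [|rewrite IH]; ring. Qed.

Lemma rsum_scal n c f : rsum n (fun i => c * f i) = c * rsum n f.
Proof. induction n as [|n IH]; simpl; [|rewrite IH]; ring. Qed.

Lemma rsum_scal_r n c f : rsum n (fun i => f i * c) = rsum n f * c.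
Proof. induction n as [|n IH]; simpl; [|rewrite IH]; ring. Qed.

Lemma rsum_minus n f g : rsum n (fun i => f i - g i) = rsum n f - rsum n g.
Proof. induction n as [|n IH]; simpl; [|rewrite IH]; ring. Qed.

Lemma rsum_const n c : rsum n (fun _ => c) = INR n * c.
Proof.
  induction n as [|n IH]; [simpl; ring|].
  rewrite S_INR; simpl rsum; rewrite IH; ring.
Qed.

Lemma rsum_0 n f : (forall i, (i < n)%nat -> f i = 0) -> rsum n f = 0.
Proof.
  intros H; rewrite (rsum_ext n f (fun _ => 0)); [rewrite rsum_const; ring|auto].
Qed.

Lemma rsum_nonneg n f : (forall i, (i < n)%nat -> 0 <= f i) -> 0 <= rsum n f.
Proof.
  intros H; rewrite <- (rsum_0 n (fun _ => 0)) by auto; apply rsum_le; auto.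
Qed.

Lemma rsum_swap n m f :
  rsum n (fun i => rsum m (fun j => f i j)) = rsum m (fun j => rsum n (fun i => f i j)).
Proof.
  induction n as [|n IH]; simpl.
  - symmetry; apply rsum_0; auto.
  - rewrite IH, <- rsum_plus; reflexivity.
Qed.

Lemma rsum_S_l n f : rsum (S n) f = f 0%nat + rsum n (fun i => f (S i)).
Proof.
  induction n as [|n IH]; [simpl; ring|].
  change (rsum (S n) f + f (S n) = f 0%nat + (rsum n (fun i => f (S i)) + f (S n))).
  rewrite IH; ring.
Qed.

Lemma rsum_nonneg_eq0 n f :
  (forall i, (i < n)%nat -> 0 <= f i) -> rsum n f = 0 ->
  forall i, (i < n)%nat -> f i = 0.
Proof.
  induction n as [|n IH]; simpl; intros H H0 i Hi; [lia|].
  assert (0 <= rsum n f) by (apply rsum_nonneg; auto).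
  assert (0 <= f n) by auto.
  destruct (Nat.eq_dec i n) as [->|]; [lra|].
  apply IH; [auto|lra|lia].
Qed.

Definition bv (l i : nat) : R := if Nat.eqb i l then 1 else 0.

Lemma rsum_bv n l f : (l < n)%nat -> rsum n (fun i => bv l i * f i) = f l.
Proof.
  induction n as [|n IH]; intros H; [lia|]; simpl; unfold bv at 2.
  destruct (Nat.eqb_spec n l) as [->|].
  - rewrite rsum_0; [ring|]; intros i Hi; unfold bv.
    destruct (Nat.eqb_spec i l); [lia|ring].
  - rewrite IH by lia; ring.
Qed.

(** * Inner products, matrix action and iterates *)

Definition ip (n : nat) (x y : nat -> R) : R := rsum n (fun i => x i * y i).

Definition mv (n : nat) (M : nat -> nat -> R) (v : nat -> R) (i : nat) : R :=
  rsum n (fun j => M i j * v j).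

Definition it (n : nat) (M : nat -> nat -> R) (k : nat) (v : nat -> R) : nat -> R :=
  Nat.iter k (mv n M) v.

Definition sym (n : nat) (M : nat -> nat -> R) : Prop :=
  forall i j, (i < n)%nat -> (j < n)%nat -> M i j = M j i.

Definition psd (n : nat) (M : nat -> nat -> R) : Prop :=
  sym n M /\ forall v, 0 <= quad n M v.

Lemma ip_comm n x y : ip n x y = ip n y x.
Proof. apply rsum_ext; intros; ring. Qed.

Lemma ip_ext n x y x' y' :
  (forall i, (i < n)%nat -> x i = x' i) -> (forall i, (i < n)%nat -> y i = y' i) ->
  ip n x y = ip n x' y'.
Proof. intros H H'; apply rsum_ext; intros; rewrite H, H'; auto. Qed.

Lemma ip_lin_l n a b x y z :
  ip n (fun i => a * x i + b * y i) z = a * ip n x z + b * ip n y z.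
Proof.
  unfold ip; rewrite <- !rsum_scal, <- rsum_plus; apply rsum_ext; intros; ring.
Qed.

Lemma ip_lin_r n a b x y z :
  ip n z (fun i => a * x i + b * y i) = a * ip n z x + b * ip n z y.
Proof. rewrite ip_comm, ip_lin_l, !(ip_comm n z); reflexivity. Qed.

Lemma ip_self_nonneg n x : 0 <= ip n x x.
Proof. apply rsum_nonneg; intros; nra. Qed.

Lemma ip_bv n l x : (l < n)%nat -> ip n (bv l) x = x l.
Proof. apply rsum_bv. Qed.

Lemma quad_ip n M v : quad n M v = ip n v (mv n M v).
Proof.
  apply rsum_ext; intros; unfold mv; rewrite <- rsum_scal.
  apply rsum_ext; intros; ring.
Qed.

Lemma mv_lin n M a b x y i :
  mv n M (fun j => a * x j + b * y j) i = a * mv n M x i + b * mv n M y i.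
Proof.
  unfold mv; rewrite <- !rsum_scal, <- rsum_plus; apply rsum_ext; intros; ring.
Qed.

Lemma mv_ext n M M' x x' i :
  (forall j, (j < n)%nat -> M i j = M' i j) -> (forall j, (j < n)%nat -> x j = x' j) ->
  mv n M x i = mv n M' x' i.
Proof. intros H H'; apply rsum_ext; intros; rewrite H, H'; auto. Qed.

Lemma mv_adj n M x y : sym n M -> ip n x (mv n M y) = ip n (mv n M x) y.
Proof.
  intros HM; unfold ip, mv.
  rewrite (rsum_ext n _ (fun i => rsum n (fun j => x i * M i j * y j))).
  2:{ intros; rewrite <- rsum_scal; apply rsum_ext; intros; ring. }
  rewrite rsum_swap; apply rsum_ext; intros j Hj.
  rewrite <- rsum_scal_r; apply rsum_ext; intros i Hi; rewrite (HM i j); auto; ring.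
Qed.

Lemma it_ext n M M' k x x' :
  (forall i j, (i < n)%nat -> (j < n)%nat -> M i j = M' i j) ->
  (forall j, (j < n)%nat -> x j = x' j) ->
  forall i, (i < n)%nat -> it n M k x i = it n M' k x' i.
Proof.
  intros HM Hx; induction k as [|k IH]; intros i Hi; [apply Hx; auto|].
  apply mv_ext; auto.
Qed.

Lemma it_S n M k x : it n M (S k) x = mv n M (it n M k x).
Proof. reflexivity. Qed.

Lemma it_lin n M k a b x y i : (i < n)%nat ->
  it n M k (fun j => a * x j + b * y j) i = a * it n M k x i + b * it n M k y i.
Proof.
  revert i; induction k as [|k IH]; intros i Hi; [reflexivity|].
  rewrite !it_S, <- mv_lin; apply mv_ext; auto.
Qed.

Lemma ip_it_shift n M i j x y : sym n M ->
  ip n (it n M i x) (it n M j y) = ip n x (it n M (i + j) y).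
Proof.
  intros HM; revert j; induction i as [|i IH]; intros j; [reflexivity|].
  rewrite it_S, <- mv_adj by auto.
  change (mv n M (it n M j y)) with (it n M (S j) y).
  rewrite IH; f_equal; f_equal; lia.
Qed.

Lemma ip_it_adj n M k x y : sym n M -> ip n x (it n M k y) = ip n (it n M k x) y.
Proof.
  intros HM; change y with (it n M 0 y) at 2.
  rewrite ip_it_shift by auto; f_equal; f_equal; lia.
Qed.

(** * Moments of a positive semidefinite matrix *)

(** Moments of the spectral measure of [M] at [u]; the inequalities that a diagonalization would
    give come from Cauchy-Schwarz instead. *)
Definition mom (n : nat) (M : nat -> nat -> R) (u : nat -> R) (k : nat) : R :=
  ip n u (it n M k u).

(** By parity, the moment is either the squared norm of [M^j u] or the form of [M] at [M^j u]. *)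
Lemma mom_nonneg n M u k : psd n M -> 0 <= mom n M u k.
Proof.
  intros [Hs Hp]; unfold mom.
  destruct (Nat.Even_or_Odd k) as [[j ->]|[j ->]].
  - replace (2 * j)%nat with (j + j)%nat by lia.
    rewrite <- ip_it_shift by auto; apply ip_self_nonneg.
  - replace (2 * j + 1)%nat with (j + S j)%nat by lia.
    rewrite <- ip_it_shift by auto; rewrite it_S, <- quad_ip; apply Hp.
Qed.

Lemma mom_lin n M k a b x y : sym n M ->
  mom n M (fun i => a * x i + b * y i) k =
  a * a * mom n M x k + 2 * a * b * ip n x (it n M k y) + b * b * mom n M y k.
Proof.
  intros HM; unfold mom.
  rewrite (ip_ext n _ _ (fun i => a * x i + b * y i)
             (fun i => a * it n M k x i + b * it n M k y i)).
  2: reflexivity. 2: intros; apply it_lin; auto.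
  rewrite ip_lin_l, !ip_lin_r.
  rewrite (ip_it_adj n M k y x) by auto; rewrite (ip_comm n (it n M k y) x); ring.
Qed.

Lemma discr_nonpos A B C : 0 <= A -> 0 <= C ->
  (forall t s, 0 <= t * t * A + 2 * t * s * B + s * s * C) -> B * B <= A * C.
Proof.
  intros HA HC H.
  destruct (Req_dec C 0) as [->|HC0].
  - destruct (Req_dec B 0) as [->|HB]; [nra|].
    (* With [C = 0] and [t = 1] the form is affine in [s]; this choice gives it the value [-1]. *)
    specialize (H 1 (- (A + 1) / (2 * B))).
    replace (1 * 1 * A + 2 * 1 * (- (A + 1) / (2 * B)) * B +
             - (A + 1) / (2 * B) * (- (A + 1) / (2 * B)) * 0) with (-1) in H
      by (field; auto).
    lra.
  - specialize (H C (- B)); assert (0 < C) by lra.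
    assert (0 <= C * (A * C - B * B)) by nra.
    nra.
Qed.

Lemma mom_cauchy n M k x y : psd n M ->
  ip n x (it n M k y) * ip n x (it n M k y) <= mom n M x k * mom n M y k.
Proof.
  intros HM; apply discr_nonpos; try (apply mom_nonneg; auto).
  intros t s; rewrite <- mom_lin by apply HM; apply mom_nonneg; auto.
Qed.

Lemma mom_it n M u j k : sym n M -> mom n M (it n M j u) k = mom n M u (j + (k + j)).
Proof.
  intros HM; unfold mom.
  replace (it n M k (it n M j u)) with (it n M (k + j) u).
  - apply ip_it_shift; auto.
  - unfold it; rewrite Nat.iter_add; reflexivity.
Qed.

(** Cauchy-Schwarz between [M^j u] and [M^(j+1) u], for the identity form when [a = 2j] and for the
    form of [M] when [a = 2j + 1]. *)
Lemma mom_logconvex n M u a : psd n M ->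
  mom n M u (S a) * mom n M u (S a) <= mom n M u a * mom n M u (S (S a)).
Proof.
  intros HM; assert (Hs := proj1 HM).
  destruct (Nat.Even_or_Odd a) as [[j Hj]|[j Hj]].
  - assert (H := mom_cauchy n M 0 (it n M j u) (it n M (S j) u) HM).
    rewrite !mom_it in H by auto; change (it n M 0 ?v) with v in H.
    rewrite ip_it_shift in H by auto.
    change (ip n u (it n M ?k u)) with (mom n M u k) in H.
    replace (j + S j)%nat with (S a) in H by lia.
    replace (j + (0 + j))%nat with a in H by lia.
    replace (S j + (0 + S j))%nat with (S (S a)) in H by lia.
    exact H.
  - assert (H := mom_cauchy n M 1 (it n M j u) (it n M (S j) u) HM).
    rewrite !mom_it in H by auto; change (it n M 1 (it n M (S j) u)) with (it n M (S (S j)) u) in H.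
    rewrite ip_it_shift in H by auto.
    change (ip n u (it n M ?k u)) with (mom n M u k) in H.
    replace (j + S (S j))%nat with (S a) in H by lia.
    replace (j + (1 + j))%nat with a in H by lia.
    replace (S j + (1 + S j))%nat with (S (S a)) in H by lia.
    exact H.
Qed.

(** Log-convexity makes the ratios [m_(k+1) / m_k] nondecreasing; the cross-multiplied form survives
    zero moments. *)
Lemma mom_ratio n M u i p : psd n M ->
  mom n M u (S i) * mom n M u (i + p) <= mom n M u i * mom n M u (S (i + p)).
Proof.
  intros HM; induction p as [|p IH].
  - rewrite Nat.add_0_r; lra.
  - rewrite Nat.add_succ_r; set (j := (i + p)%nat) in *.
    assert (L := mom_logconvex n M u j HM).
    assert (A := mom_nonneg n M u i HM). assert (B := mom_nonneg n M u (S i) HM).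
    assert (C := mom_nonneg n M u j HM). assert (D := mom_nonneg n M u (S j) HM).
    assert (E := mom_nonneg n M u (S (S j)) HM).
    (* A zero [m_(j+1)] kills the left side; otherwise log-convexity forces [m_j > 0], which can
       then be cancelled. *)
    destruct (Req_dec (mom n M u (S j)) 0) as [Z|Z]; [rewrite Z; nra|].
    assert (0 < mom n M u j) by nra.
    apply Rmult_le_reg_l with (mom n M u j); [auto|].
    apply Rle_trans with (mom n M u i * (mom n M u (S j) * mom n M u (S j))); nra.
Qed.

(** Moving one power from the smaller index to the larger keeps the sum of the indices and does not
    decrease the product; iterate until the smaller index is [0]. *)
Lemma mom_mul_le n M u i j : psd n M -> (i <= j)%nat ->
  mom n M u i * mom n M u j <= mom n M u 0 * mom n M u (i + j).
Proof.
  intros HM; revert j; induction i as [|i IH]; intros j Hij; [simpl; lra|].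
  apply Rle_trans with (mom n M u i * mom n M u (S j)).
  - replace j with (i + (j - i))%nat by lia; apply mom_ratio; auto.
  - replace (S i + j)%nat with (i + S j)%nat by lia; apply IH; lia.
Qed.

Lemma mom_supermul n M u i j : psd n M ->
  mom n M u i * mom n M u j <= mom n M u 0 * mom n M u (i + j).
Proof.
  intros HM; destruct (Nat.le_ge_cases i j); [apply mom_mul_le; auto|].
  rewrite Rmult_comm, Nat.add_comm; apply mom_mul_le; auto.
Qed.

(** Jensen for the spectral measure, by induction through [m_1 m_k <= m_0 m_(k+1)]. *)
Lemma mom_lower n M v y k : psd n M -> 0 < sqnorm n v -> 0 <= y ->
  y * sqnorm n v <= quad n M v -> y ^ k * sqnorm n v <= mom n M v k.
Proof.
  intros HM Hv Hy H; induction k as [|k IH]; [simpl; unfold mom, ip, it, sqnorm; simpl; lra|].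
  assert (L := mom_supermul n M v 1 k HM).
  change (mom n M v 0) with (sqnorm n v) in L.
  change (mom n M v 1) with (ip n v (mv n M v)) in L; rewrite <- quad_ip in L.
  assert (K := mom_nonneg n M v k HM); simpl pow; simpl Nat.add in L.
  apply Rmult_le_reg_l with (sqnorm n v); [auto|].
  apply Rle_trans with (y * sqnorm n v * mom n M v k).
  - replace (sqnorm n v * (y * y ^ k * sqnorm n v))
      with (y * sqnorm n v * (y ^ k * sqnorm n v)) by ring.
    apply Rmult_le_compat_l; [nra|exact IH].
  - apply Rle_trans with (2 := L); apply Rmult_le_compat_r; auto.
Qed.

Lemma mom_upper n M v b k : psd n M -> 0 <= b ->
  (forall w, quad n M w <= b * sqnorm n w) -> mom n M v (S k) <= b * mom n M v k.
Proof.
  intros HM Hb H; assert (Hs := proj1 HM).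
  destruct (Nat.Even_or_Odd k) as [[j Hj]|[j Hj]].
  - specialize (H (it n M j v)); rewrite quad_ip in H.
    change (mv n M (it n M j v)) with (it n M (S j) v) in H.
    change (sqnorm n (it n M j v)) with (ip n (it n M j v) (it n M j v)) in H.
    rewrite !ip_it_shift in H by auto.
    replace (j + S j)%nat with (S k) in H by lia.
    replace (j + j)%nat with k in H by lia; exact H.
  - (* M^2 <= b M by Cauchy-Schwarz for the form of M, applied to w and M w *)
    set (w := it n M j v).
    assert (C := mom_cauchy n M 1 (mv n M w) w HM).
    assert (Q := H (mv n M w)).
    change (mom n M (mv n M w) 1) with (ip n (mv n M w) (mv n M (mv n M w))) in C.
    rewrite <- quad_ip in C.
    change (ip n (mv n M w) (it n M 1 w)) with (sqnorm n (mv n M w)) in C.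
    assert (E1 : mom n M v (S k) = sqnorm n (mv n M w)).
    { change (sqnorm n (mv n M w)) with (ip n (it n M (S j) v) (it n M (S j) v)).
      rewrite ip_it_shift by auto; unfold mom; f_equal; f_equal; lia. }
    assert (E2 : mom n M v k = mom n M w 1).
    { unfold w; rewrite mom_it by auto; f_equal; lia. }
    rewrite E1, E2.
    assert (P := mom_nonneg n M w 1 HM).
    assert (P2 : 0 <= sqnorm n (mv n M w)) by apply ip_self_nonneg.
    set (q := sqnorm n (mv n M w)) in *; set (m := mom n M w 1) in *.
    destruct (Req_dec q 0) as [->|]; [nra|].
    apply Rmult_le_reg_l with q; [lra|].
    apply Rle_trans with (quad n M (mv n M w) * m); [exact C|nra].
Qed.

(** * Truncated trace exponential *)

Definition tr (n : nat) (M : nat -> nat -> R) (k : nat) : R :=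
  rsum n (fun l => mom n M (bv l) k).

Definition texp (n K : nat) (M : nat -> nat -> R) : R :=
  rsum K (fun k => tr n M k / INR (fact k)).

Lemma texp_ext n K M M' :
  (forall i j, (i < n)%nat -> (j < n)%nat -> M i j = M' i j) ->
  texp n K M = texp n K M'.
Proof.
  intros H; apply rsum_ext; intros k _; f_equal; apply rsum_ext; intros l _.
  apply ip_ext; [reflexivity|]; apply it_ext; auto.
Qed.

Lemma vec_bv_expand n v i : (i < n)%nat -> v i = rsum n (fun l => v l * bv l i).
Proof.
  intros Hi; rewrite (rsum_ext n _ (fun l => bv i l * v l)).
  - rewrite rsum_bv; auto.
  - intros l _; unfold bv; rewrite Nat.eqb_sym; ring.
Qed.

Lemma it_expand n M k v i : (i < n)%nat ->
  it n M k v i = rsum n (fun l => v l * it n M k (bv l) i).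
Proof.
  revert i; induction k as [|k IH]; intros i Hi; [apply vec_bv_expand; auto|].
  rewrite it_S; unfold mv at 1.
  rewrite (rsum_ext n _ (fun j => rsum n (fun l => v l * (M i j * it n M k (bv l) j)))).
  - rewrite rsum_swap; apply rsum_ext; intros l _; rewrite it_S; unfold mv.
    rewrite rsum_scal; reflexivity.
  - intros j Hj; rewrite IH by auto; rewrite <- rsum_scal; apply rsum_ext; intros; ring.
Qed.

Lemma mom_expand n M k v :
  mom n M v k =
  rsum n (fun p => rsum n (fun l => v p * v l * ip n (bv p) (it n M k (bv l)))).
Proof.
  apply rsum_ext; intros p Hp; rewrite it_expand by auto.
  rewrite <- rsum_scal; apply rsum_ext; intros l Hl.
  rewrite ip_bv by auto; ring.
Qed.

(* Expands [0 <= sum_(p,l) Q (v_p e_l - v_l e_p)] for the form [Q] of [M^k]. *)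
Lemma mom_le_trace n M v k : psd n M -> mom n M v k <= sqnorm n v * tr n M k.
Proof.
  intros HM.
  assert (H : 0 <= rsum n (fun p => rsum n (fun l =>
     mom n M (fun i => v p * bv l i + - v l * bv p i) k))).
  { apply rsum_nonneg; intros; apply rsum_nonneg; intros; apply mom_nonneg; auto. }
  rewrite (rsum_ext n _ (fun p =>
     v p * v p * tr n M k + rsum n (fun l => v l * v l) * mom n M (bv p) k +
     (-2) * rsum n (fun l => v p * v l * ip n (bv p) (it n M k (bv l))))) in H.
  - rewrite !rsum_plus, rsum_scal_r, !rsum_scal, <- mom_expand in H.
    change (rsum n (fun i => v i * v i)) with (sqnorm n v) in H.
    change (rsum n (fun i => mom n M (bv i) k)) with (tr n M k) in H; lra.
  - intros p Hp; unfold tr; rewrite <- !rsum_scal, <- rsum_scal_r, <- !rsum_plus.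
    apply rsum_ext; intros l Hl; rewrite mom_lin by apply HM.
    rewrite (ip_it_adj n M k (bv l)) by apply HM.
    rewrite (ip_comm n (it n M k (bv l))); ring.
Qed.

(** The lower half of the Laplace transform method: a single vector with Rayleigh quotient at least
    [y] already makes the trace large, since the trace of a semidefinite power dominates each of its
    Rayleigh quotients. *)
Lemma texp_lower n K M v y : psd n M -> 0 < sqnorm n v -> 0 <= y ->
  y * sqnorm n v <= quad n M v ->
  rsum K (fun k => y ^ k / INR (fact k)) <= texp n K M.
Proof.
  intros HM Hv Hy H; apply rsum_le; intros k _.
  apply Rmult_le_compat_r; [left; apply Rinv_0_lt_compat, INR_fact_lt_0|].
  apply Rmult_le_reg_l with (sqnorm n v); [auto|].
  apply Rle_trans with (mom n M v k); [|apply mom_le_trace; auto].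
  rewrite Rmult_comm; apply mom_lower; auto.
Qed.

Lemma rsum_sum_f_R0 f K : rsum (S K) f = sum_f_R0 f K.
Proof. induction K as [|K IH]; [simpl; ring|]. simpl in *; rewrite IH; reflexivity. Qed.

Lemma exp_partial_cv y : Un_cv (fun K => rsum (S K) (fun k => y ^ k / INR (fact k))) (exp y).
Proof.
  intros e He; destruct (E1_cvg y e He) as [N HN]; exists N; intros m Hm.
  rewrite rsum_sum_f_R0; specialize (HN m Hm); unfold E1 in HN.
  rewrite (sum_eq _ (fun k => / INR (fact k) * y ^ k)); [exact HN|].
  intros; unfold Rdiv; ring.
Qed.

Lemma exp_partial_le y K : 0 <= y -> rsum K (fun k => y ^ k / INR (fact k)) <= exp y.
Proof.
  intros Hy.
  assert (P : forall k, 0 <= y ^ k / INR (fact k)).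
  { intros; apply Rmult_le_pos; [apply pow_le; auto|].
    left; apply Rinv_0_lt_compat, INR_fact_lt_0. }
  apply Rle_trans with (rsum (S K) (fun k => y ^ k / INR (fact k))).
  - simpl; specialize (P K); lra.
  - apply (growing_ineq (fun K => rsum (S K) (fun k => y ^ k / INR (fact k)))).
    + intros m; simpl; specialize (P (S m)); simpl in P; lra.
    + apply exp_partial_cv.
Qed.

Lemma sqnorm_bv n l : (l < n)%nat -> sqnorm n (bv l) = 1.
Proof.
  intros H; change (ip n (bv l) (bv l) = 1); rewrite ip_bv by auto.
  unfold bv; rewrite Nat.eqb_refl; reflexivity.
Qed.

(** The dimension factor of the matrix bound arises here, from estimating each of the [n] diagonal
    entries of [M^k] by [b^k]. *)
Lemma texp_upper n K M b : psd n M -> 0 <= b ->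
  (forall w, quad n M w <= b * sqnorm n w) -> texp n K M <= INR n * exp b.
Proof.
  intros HM Hb H.
  apply Rle_trans with (rsum K (fun k => INR n * (b ^ k / INR (fact k)))).
  - apply rsum_le; intros k _; unfold Rdiv; rewrite <- Rmult_assoc.
    apply Rmult_le_compat_r; [left; apply Rinv_0_lt_compat, INR_fact_lt_0|].
    rewrite <- rsum_const; apply rsum_le; intros l Hl.
    induction k as [|k IH].
    + change (mom n M (bv l) 0) with (sqnorm n (bv l)); rewrite sqnorm_bv; simpl; auto; lra.
    + apply Rle_trans with (b * mom n M (bv l) k); [apply mom_upper; auto|].
      simpl; apply Rmult_le_compat_l; auto.
  - rewrite rsum_scal; apply Rmult_le_compat_l; [apply pos_INR|].
    apply exp_partial_le; auto.
Qed.

(** * Rank-one perturbations *)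

Definition rank1 (M : nat -> nat -> R) (u : nat -> R) (c : R) (i j : nat) : R :=
  M i j + c * (u i * u j).

Lemma mv_rank1 n M u c x i : mv n (rank1 M u c) x i = mv n M x i + c * ip n u x * u i.
Proof.
  unfold mv, rank1, ip.
  replace (c * rsum n (fun j => u j * x j) * u i)
    with (c * u i * rsum n (fun j => u j * x j)) by ring.
  rewrite <- rsum_scal, <- rsum_plus; apply rsum_ext; intros; ring.
Qed.

Lemma quad_rank1 n M u c v : quad n (rank1 M u c) v = quad n M v + c * (ip n u v * ip n u v).
Proof.
  rewrite !quad_ip.
  rewrite (ip_ext n v _ v (fun i => 1 * mv n M v i + c * ip n u v * u i)).
  - rewrite ip_lin_r, (ip_comm n v u); ring.
  - reflexivity.
  - intros; rewrite mv_rank1; ring.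
Qed.

Lemma sym_rank1 n M u c : sym n M -> sym n (rank1 M u c).
Proof. intros H i j Hi Hj; unfold rank1; rewrite (H i j); auto; ring. Qed.

Lemma psd_rank1 n M u c : psd n M -> 0 <= c -> psd n (rank1 M u c).
Proof.
  intros [Hs Hp] Hc; split; [apply sym_rank1; auto|].
  intros v; rewrite quad_rank1; specialize (Hp v).
  assert (0 <= ip n u v * ip n u v) by nra; nra.
Qed.

Lemma derivable_pt_lim_ext f g x l :
  (forall y, f y = g y) -> derivable_pt_lim f x l -> derivable_pt_lim g x l.
Proof.
  intros H D e He; destruct (D e He) as [d Hd]; exists d; intros; rewrite <- !H; auto.
Qed.

Lemma derivable_pt_lim_rsum n (F : nat -> R -> R) (F' : nat -> R) x :
  (forall i, (i < n)%nat -> derivable_pt_lim (F i) x (F' i)) ->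
  derivable_pt_lim (fun y => rsum n (fun i => F i y)) x (rsum n F').
Proof.
  induction n as [|n IH]; intros H; simpl; [apply derivable_pt_lim_const|].
  apply (derivable_pt_lim_plus (fun y => rsum n (fun i => F i y)) (F n)); auto.
Qed.

Lemma rank1_ip_it_S n M u c w v k : sym n M ->
  ip n w (it n (rank1 M u c) (S k) v) =
  ip n (mv n M w) (it n (rank1 M u c) k v) +
  c * (ip n w u * ip n u (it n (rank1 M u c) k v)).
Proof.
  intros HM; rewrite it_S.
  rewrite (ip_ext n w _ w (fun i => 1 * mv n M (it n (rank1 M u c) k v) i +
              c * ip n u (it n (rank1 M u c) k v) * u i)).
  - rewrite ip_lin_r, mv_adj by auto; ring.
  - reflexivity.
  - intros; rewrite mv_rank1; ring.
Qed.

(** Product rule: with [N = M + c u u^T], the derivative of [N^k] is the sum of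
    [N^i u u^T N^(k-1-i)]. The vector [w] stays general because peeling off one factor replaces it
    by [M w]. *)
Lemma ip_it_derive n M u v c k : sym n M -> forall w,
  derivable_pt_lim (fun c => ip n w (it n (rank1 M u c) k v)) c
    (rsum k (fun i => ip n w (it n (rank1 M u c) i u) *
                      ip n u (it n (rank1 M u c) (k - S i) v))).
Proof.
  intros HM; induction k as [|k IH]; intros w;
    [apply (derivable_pt_lim_const (ip n w v))|].
  apply derivable_pt_lim_ext with
    (fun c => ip n (mv n M w) (it n (rank1 M u c) k v) +
              c * (ip n w u * ip n u (it n (rank1 M u c) k v))).
  { intros; symmetry; apply rank1_ip_it_S; auto. }
  rewrite rsum_S_l.
  set (D := fun w => rsum k (fun i => ip n w (it n (rank1 M u c) i u) *
                      ip n u (it n (rank1 M u c) (k - S i) v))).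
  match goal with |- derivable_pt_lim _ _ ?L => replace L with
   (D (mv n M w) + (1 * (ip n w u * ip n u (it n (rank1 M u c) k v)) +
      c * (ip n w u * D u))) end.
  - apply (derivable_pt_lim_plus (fun c => ip n (mv n M w) (it n (rank1 M u c) k v))
      (fun c => c * (ip n w u * ip n u (it n (rank1 M u c) k v)))); [apply IH|].
    apply (derivable_pt_lim_mult (fun c => c)
      (fun c => ip n w u * ip n u (it n (rank1 M u c) k v))); [apply derivable_pt_lim_id|].
    apply (derivable_pt_lim_scal (fun c => ip n u (it n (rank1 M u c) k v))); apply IH.
  - change (it n (rank1 M u c) 0 u) with u; replace (S k - 1)%nat with k by lia.
    unfold D; rewrite <- !rsum_scal.
    match goal with |- ?a + (1 * ?b + ?d) = _ =>
      replace (a + (1 * b + d)) with (b + (a + d)) by ring end.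
    f_equal; rewrite <- rsum_plus; apply rsum_ext; intros i Hi.
    rewrite rank1_ip_it_S by auto; simpl Nat.sub; ring.
Qed.

(** By cyclicity of the trace, all [k] terms of the product rule equal the same moment of order
    [k - 1]; at [k = 0] the factor [INR k] makes the value of [pred] harmless. *)
Lemma trace_derive n M u c k : sym n M ->
  derivable_pt_lim (fun c => tr n (rank1 M u c) k) c
    (INR k * mom n (rank1 M u c) u (pred k)).
Proof.
  intros HM; assert (HMc := sym_rank1 n M u c HM).
  set (N := rank1 M u c) in *.
  replace (INR k * mom n N u (pred k)) with
    (rsum n (fun l => rsum k (fun i => ip n (bv l) (it n N i u) *
                      ip n u (it n N (k - S i) (bv l))))).
  - unfold tr.
    apply (derivable_pt_lim_rsum n (fun l c => mom n (rank1 M u c) (bv l) k)).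
    intros; apply ip_it_derive; auto.
  - rewrite rsum_swap, <- rsum_const; apply rsum_ext; intros i Hi.
    rewrite (rsum_ext n _ (fun l => it n N i u l * it n N (k - S i) u l)).
    + change (ip n (it n N i u) (it n N (k - S i) u) = mom n N u (pred k)).
      rewrite ip_it_shift by auto; unfold mom; f_equal; f_equal; lia.
    + intros l Hl; rewrite (ip_it_adj n N _ u) by auto.
      rewrite (ip_comm n _ (bv l)), !ip_bv by auto; reflexivity.
Qed.

(** The derivative of the truncated trace exponential along [u u^T]; differentiating costs one term
    of the truncation. *)
Definition mexp (n K : nat) (M : nat -> nat -> R) (u : nat -> R) : R :=
  rsum K (fun k => mom n M u k / INR (fact k)).

Lemma div_fact_S k x : INR (S k) * x / INR (fact (S k)) = x / INR (fact k).
Proof.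
  rewrite fact_simpl, mult_INR; field; split; [apply INR_fact_neq_0|apply not_0_INR; lia].
Qed.

Lemma texp_derive n K M u c : sym n M ->
  derivable_pt_lim (fun c => texp n (S K) (rank1 M u c)) c (mexp n K (rank1 M u c) u).
Proof.
  intros HM.
  replace (mexp n K (rank1 M u c) u) with
    (rsum (S K) (fun k => INR k * mom n (rank1 M u c) u (pred k) * / INR (fact k))).
  - apply (derivable_pt_lim_rsum (S K) (fun k c => tr n (rank1 M u c) k / INR (fact k))).
    intros k _; apply derivable_pt_lim_ext with
      (fun c => / INR (fact k) * tr n (rank1 M u c) k); [intros; unfold Rdiv; ring|].
    rewrite Rmult_comm.
    apply (derivable_pt_lim_scal (fun c => tr n (rank1 M u c) k)); apply trace_derive; auto.
  - rewrite rsum_S_l; simpl INR at 1; rewrite !Rmult_0_l, Rplus_0_l.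
    apply rsum_ext; intros k _; apply div_fact_S.
Qed.

(** The derivative of [m_k] is a sum of [k] products [m_i m_(k-1-i)], each at most [m_(k-1)] for a
    unit vector; dividing by [k!] leaves [m_(k-1) / (k-1)!], a term of the same series. *)
Lemma mexp_derive n K M u c : psd n M -> 0 <= c -> sqnorm n u = 1 ->
  exists l, derivable_pt_lim (fun c => mexp n K (rank1 M u c) u) c l /\
    l <= mexp n K (rank1 M u c) u.
Proof.
  intros HM Hc Hu; assert (HN := psd_rank1 n M u c HM Hc); set (N := rank1 M u c) in *.
  exists (rsum K (fun k => / INR (fact k) *
     rsum k (fun i => mom n N u i * mom n N u (k - S i)))); split.
  - apply (derivable_pt_lim_rsum K (fun k c => mom n (rank1 M u c) u k / INR (fact k))).
    intros k _; apply derivable_pt_lim_ext with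
      (fun c => / INR (fact k) * mom n (rank1 M u c) u k); [intros; unfold Rdiv; ring|].
    apply (derivable_pt_lim_scal (fun c => mom n (rank1 M u c) u k)).
    apply ip_it_derive; apply HM.
  - assert (P : forall k, 0 <= mom n N u k / INR (fact k)).
    { intros; apply Rmult_le_pos; [apply mom_nonneg; auto|].
      left; apply Rinv_0_lt_compat, INR_fact_lt_0. }
    destruct K as [|K]; [simpl; unfold mexp; simpl; lra|].
    rewrite rsum_S_l; simpl rsum at 1; rewrite Rmult_0_r, Rplus_0_l.
    (* The resulting sum is one term short of the original truncation, and the missing term is
       nonnegative, so truncating preserves the inequality. *)
    apply Rle_trans with (mexp n K N u); [|unfold mexp; simpl; specialize (P K); lra].
    apply rsum_le; intros k _; rewrite <- div_fact_S, Rmult_comm.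
    apply Rmult_le_compat_r; [left; apply Rinv_0_lt_compat, INR_fact_lt_0|].
    rewrite <- rsum_const; apply rsum_le; intros i Hi.
    assert (L := mom_supermul n N u i (S k - S i) HN).
    change (mom n N u 0) with (sqnorm n u) in L; rewrite Hu in L.
    replace (i + (S k - S i))%nat with k in L by lia; lra.
Qed.

(** * Concavity in the exponential of the coefficient *)

Lemma nonincreasing_of_deriv f (f' : R -> R) a b : a <= b ->
  (forall c, a <= c <= b -> derivable_pt_lim f c (f' c)) ->
  (forall c, a <= c <= b -> f' c <= 0) -> f b <= f a.
Proof.
  intros [H|<-] D N; [|lra].
  destruct (MVT_cor2 f f' a b H D) as [c [E [H1 H2]]].
  assert (f' c <= 0) by (apply N; lra); nra.
Qed.

(* [h' <= h] says that [exp(-c) h(c)] is nonincreasing, i.e. that [f] is a concave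
   function of [exp c]. *)
Lemma concave_in_exp (f h : R -> R) :
  (forall c, 0 <= c -> derivable_pt_lim f c (h c)) ->
  (forall c, 0 <= c -> exists l, derivable_pt_lim h c l /\ l <= h c) ->
  forall p k, 0 < p < 1 -> 0 <= k ->
  p * f k + (1 - p) * f 0 <= f (ln (1 - p + p * exp k)).
Proof.
  intros Df Dh p k Hp Hk.
  (* [exp s] is the average of [exp k] and [exp 0] with weights [p] and [1 - p]. *)
  set (s := ln (1 - p + p * exp k)).
  assert (E1 : 1 <= exp k) by (assert (L := exp_ineq1_le k); lra).
  assert (Es : exp s = 1 - p + p * exp k) by (apply exp_ln; nra).
  assert (Hs0 : 0 <= s).
  { destruct (Rle_lt_dec 0 s); auto.
    assert (exp s < exp 0) by (apply exp_increasing; auto); rewrite exp_0 in *; nra. }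
  assert (Hsk : s <= k).
  { destruct (Rle_lt_dec s k); auto.
    assert (exp k < exp s) by (apply exp_increasing; auto); nra. }
  assert (mono : forall x y, 0 <= x -> x <= y -> exp (- y) * h y <= exp (- x) * h x).
  { intros x y Hx Hxy.
    (* Placing [0 <= c] under the existential lets choice pick a derivative for every real [c], with
       the dummy value [0] available for negative ones. *)
    assert (D : forall c, exists l, 0 <= c ->
       derivable_pt_lim (fun c => exp (- c) * h c) c l /\ l <= 0).
    { intros c; destruct (Rle_lt_dec 0 c) as [Hc|Hc]; [|exists 0; lra].
      destruct (Dh c Hc) as [l [Dl Hl]].
      exists (- exp (- c) * h c + exp (- c) * l); intros _; split.
      - apply (derivable_pt_lim_mult (fun c => exp (- c)) h); auto.
        replace (- exp (- c)) with (exp (- c) * -1) by ring.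
        apply (derivable_pt_lim_comp (fun c => - c) exp).
        + apply (derivable_pt_lim_opp (fun c => c)), derivable_pt_lim_id.
        + apply derivable_pt_lim_exp.
      - assert (0 < exp (- c)) by apply exp_pos; nra. }
    apply (nonincreasing_of_deriv (fun c => exp (- c) * h c)
      (fun c => proj1_sig (constructive_indefinite_description _ (D c))) x y Hxy);
      intros c Hc; destruct (constructive_indefinite_description _ (D c)) as [l Hl];
      simpl; apply Hl; lra. }
  (* Slope at [s] of [f] as a function of [exp c]. The facts [A] and [B] below say that at [k] and
     at [0] the graph lies under this tangent; their weighted sum is the claim. *)
  set (g := exp (- s) * h s).
  assert (Dg : forall c, 0 <= c -> derivable_pt_lim (fun c => f c - g * exp c) c (h c - g * exp c)).
  { intros c Hc; apply (derivable_pt_lim_minus f (fun c => g * exp c)); auto.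
    apply (derivable_pt_lim_scal exp), derivable_pt_lim_exp. }
  assert (Eh : forall c, h c - g * exp c = exp c * (exp (- c) * h c - g)).
  { intros c; rewrite exp_Ropp; field; apply Rgt_not_eq, exp_pos. }
  assert (A : f k - g * exp k <= f s - g * exp s).
  { apply (nonincreasing_of_deriv (fun c => f c - g * exp c) (fun c => h c - g * exp c) s k Hsk).
    - intros; apply Dg; lra.
    - intros c Hc; rewrite Eh; assert (exp (- c) * h c <= g) by (apply mono; lra).
      assert (0 < exp c) by apply exp_pos; nra. }
  assert (B : - (f s - g * exp s) <= - (f 0 - g * exp 0)).
  { apply (nonincreasing_of_deriv (fun c => - (f c - g * exp c)) (fun c => - (h c - g * exp c)) 0 s Hs0).
    - intros; apply (derivable_pt_lim_opp (fun c => f c - g * exp c)); apply Dg; lra.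
    - intros c Hc; rewrite Eh; assert (g <= exp (- c) * h c) by (apply mono; lra).
      assert (0 < exp c) by apply exp_pos; nra. }
  rewrite exp_0 in B; rewrite Es in A, B.
  assert (A' := Rmult_le_compat_l p _ _ ltac:(lra) A).
  assert (B' := Rmult_le_compat_l (1 - p) _ _ ltac:(lra) B).
  nra.
Qed.

Lemma texp_rank1_concave n K M u p k : psd n M -> sqnorm n u = 1 -> 0 < p < 1 -> 0 <= k ->
  p * texp n (S K) (rank1 M u k) + (1 - p) * texp n (S K) (rank1 M u 0) <=
  texp n (S K) (rank1 M u (ln (1 - p + p * exp k))).
Proof.
  intros HM Hu Hp Hk.
  apply (concave_in_exp (fun c => texp n (S K) (rank1 M u c))
          (fun c => mexp n K (rank1 M u c) u)); auto.
  - intros; apply texp_derive, HM.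
  - intros; apply mexp_derive; auto.
Qed.

(** * Optimality certificate *)

Lemma quad_bv2 n X a b i k : sym n X -> (i < n)%nat -> (k < n)%nat ->
  quad n X (fun j => a * bv i j + b * bv k j) =
  a * a * X i i + 2 * a * b * X i k + b * b * X k k.
Proof.
  intros Hs Hi Hk; rewrite quad_ip.
  assert (E : forall p l, (p < n)%nat -> (l < n)%nat -> ip n (bv p) (it n X 1 (bv l)) = X p l).
  { intros p l Hp Hl; rewrite ip_bv by auto; unfold it; simpl; unfold mv.
    rewrite (rsum_ext n _ (fun j => bv l j * X p j)) by (intros; ring).
    apply rsum_bv; auto. }
  change (mv n X ?v) with (it n X 1 v).
  change (ip n ?v (it n X 1 ?v)) with (mom n X v 1).
  rewrite mom_lin by auto; unfold mom; rewrite !E by auto; reflexivity.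
Qed.

Lemma psd_minor n X i k : psd n X -> (i < n)%nat -> (k < n)%nat ->
  X i k * X i k <= X i i * X k k.
Proof.
  intros [Hs Hp] Hi Hk.
  assert (Q : forall a b, 0 <= a * a * X i i + 2 * a * b * X i k + b * b * X k k).
  { intros a b; rewrite <- (quad_bv2 n) by auto; apply Hp. }
  apply discr_nonpos; auto.
  - specialize (Q 1 0); lra.
  - specialize (Q 0 1); lra.
Qed.

(* One step of the Cholesky factorization: the Schur complement of [X k k]. *)
Lemma psd_schur n X k : psd n X -> (k < n)%nat -> 0 < X k k ->
  psd n (fun i j => X i j - X i k * X j k / X k k).
Proof.
  intros HX Hk H0; destruct HX as [Hs Hp]; split.
  - intros i j Hi Hj; rewrite (Hs i j) by auto; field; lra.
  - intros v; set (s := ip n (fun i => X i k) v).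
    assert (E : quad n (fun i j => X i j - X i k * X j k / X k k) v = quad n X v - s * s / X k k).
    { transitivity (quad n (rank1 X (fun i => X i k) (- / X k k)) v).
      - unfold rank1, quad; apply rsum_ext; intros; apply rsum_ext; intros; field; lra.
      - rewrite quad_rank1; fold s; field; lra. }
    rewrite E.
    (* Minimizing the form of [X] over [v + r e_k] gives [r = - s / X_kk], and the minimum is the
       form of the Schur complement. *)
    assert (Q := Hp (fun i => 1 * v i + - (s / X k k) * bv k i)).
    rewrite quad_ip in Q; change (mv n X ?v) with (it n X 1 v) in Q.
    change (ip n ?v (it n X 1 ?v)) with (mom n X v 1) in Q.
    rewrite mom_lin in Q by auto.
    rewrite (ip_it_adj n X 1 v), (ip_comm n _ (bv k)), ip_bv in Q by auto.
    unfold mom in Q; rewrite (ip_bv n k) in Q by auto.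
    unfold it in Q; simpl in Q; rewrite <- quad_ip in Q.
    replace (mv n X (bv k) k) with (X k k) in Q.
    2:{ unfold mv; rewrite (rsum_ext n _ (fun j => bv k j * X k j)) by (intros; ring).
        rewrite rsum_bv; auto. }
    replace (mv n X v k) with s in Q.
    2:{ unfold s, ip, mv; apply rsum_ext; intros; rewrite (Hs k) by auto; ring. }
    match type of Q with 0 <= ?q => replace (quad n X v - s * s / X k k) with q; auto end.
    field; lra.
Qed.

(** Cholesky elimination from the last index downwards: the rows from [k] on are already zero, and
    splitting off one more row leaves a Schur complement supported on fewer rows. *)
Lemma psd_gram_supported n k : (k <= n)%nat -> forall X, psd n X ->
  (forall i j, (k <= i < n)%nat -> (j < n)%nat -> X i j = 0) ->
  exists y : nat -> nat -> R, forall i j, (i < n)%nat -> (j < n)%nat ->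
    X i j = rsum k (fun l => y l i * y l j).
Proof.
  induction k as [|k IH]; intros Hk X HX H0.
  - exists (fun _ _ => 0); intros i j Hi Hj; apply H0; lia.
  - assert (Hd : 0 <= X k k).
    { assert (Q := proj2 HX (fun j => 1 * bv k j + 0 * bv k j)).
      rewrite quad_bv2 in Q by (try apply HX; lia); lra. }
    destruct Hd as [Hd|Hd].
    + destruct (IH ltac:(lia) (fun i j => X i j - X i k * X j k / X k k)) as [y Hy].
      * apply psd_schur; auto.
      * intros i j Hi Hj.
        destruct (Nat.eq_dec i k) as [->|].
        { rewrite (proj1 HX j k) by lia; field; lra. }
        { rewrite !(H0 i) by lia; field; lra. }
      * exists (fun l i => if Nat.eqb l k then X i k / sqrt (X k k) else y l i).
        intros i j Hi Hj; simpl; rewrite Nat.eqb_refl.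
        rewrite (rsum_ext k _ (fun l => y l i * y l j)).
        2:{ intros l Hl; destruct (Nat.eqb_spec l k); [lia|reflexivity]. }
        rewrite <- Hy by auto.
        replace (X i k / sqrt (X k k) * (X j k / sqrt (X k k)))
          with (X i k * X j k / (sqrt (X k k) * sqrt (X k k)))
          by (field; apply Rgt_not_eq, sqrt_lt_R0; auto).
        rewrite sqrt_sqrt by lra; field; lra.
    (* Zero pivot: the 2 by 2 minors force the whole row [k] to vanish, so its factor is [0]. *)
    + destruct (IH ltac:(lia) X HX) as [y Hy].
      * intros i j Hi Hj; destruct (Nat.eq_dec i k) as [->|]; [|apply H0; lia].
        assert (M := psd_minor n X k j HX ltac:(lia) Hj); rewrite <- Hd in M; nra.
      * exists (fun l i => if Nat.eqb l k then 0 else y l i).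
        intros i j Hi Hj; simpl; rewrite Nat.eqb_refl, (Hy i j) by auto.
        rewrite Rmult_0_l, Rplus_0_r; apply rsum_ext; intros l Hl.
        destruct (Nat.eqb_spec l k); [lia|reflexivity].
Qed.

Lemma psd_gram n X : psd n X ->
  exists y : nat -> nat -> R, forall i j, (i < n)%nat -> (j < n)%nat ->
    X i j = rsum n (fun l => y l i * y l j).
Proof. intros HX; apply psd_gram_supported; auto; intros; lia. Qed.

(** * Sums over lists and the form of the signed Laplacian *)

Definition lsum {A : Type} (l : list A) (f : A -> R) : R :=
  fold_right (fun a acc => f a + acc) 0 l.

Lemma lsum_ext {A} (l : list A) f g : (forall a, In a l -> f a = g a) -> lsum l f = lsum l g.
Proof.
  induction l as [|b l IH]; simpl; intros H; [reflexivity|]; rewrite IH, H; auto.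
Qed.

Lemma lsum_plus {A} (l : list A) f g : lsum l (fun a => f a + g a) = lsum l f + lsum l g.
Proof. induction l as [|b l IH]; simpl; [|rewrite IH]; ring. Qed.

Lemma lsum_scal {A} (l : list A) c f : lsum l (fun a => c * f a) = c * lsum l f.
Proof. induction l as [|b l IH]; simpl; [|rewrite IH]; ring. Qed.

Lemma lsum_le {A} (l : list A) f g : (forall a, In a l -> f a <= g a) -> lsum l f <= lsum l g.
Proof.
  induction l as [|b l IH]; simpl; intros H; [lra|].
  apply Rplus_le_compat; auto.
Qed.

Lemma lsum_rsum {A} (l : list A) n f :
  lsum l (fun a => rsum n (f a)) = rsum n (fun k => lsum l (fun a => f a k)).
Proof.
  induction l as [|b l IH]; simpl; [symmetry; apply rsum_0; auto|].
  rewrite IH, <- rsum_plus; reflexivity.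
Qed.

Lemma lsum_app {A} (l m : list A) f : lsum (l ++ m) f = lsum l f + lsum m f.
Proof. induction l as [|b l IH]; simpl; [|rewrite IH]; ring. Qed.

Lemma lsum_map {A B} (h : A -> B) l f : lsum (map h l) f = lsum l (fun a => f (h a)).
Proof. induction l as [|b l IH]; simpl; [|rewrite IH]; reflexivity. Qed.

Definition sdiff (v : nat -> R) (e : nat * nat) : R :=
  (v (fst e) - v (snd e)) * (v (fst e) - v (snd e)).

Definition sg (z : bool) : R := if z then -1 else 1.

Definition proper_edge (n : nat) (e : nat * nat) : Prop :=
  (fst e < n)%nat /\ (snd e < n)%nat /\ fst e <> snd e.

Definition signed_laplacian (E : list (nat * nat)) (zs : list bool) (v : nat -> R) : R :=
  lsum (combine E zs) (fun p => sg (snd p) * sdiff v (fst p)).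

(** On an edge, [W_ij] is [g_i g_j (-1)^(Z_e)], so the hidden [x] enters only through a diagonal
    sign change; every edge contributes both of its orderings. *)
Lemma trace_W_of n E x zs X : Forall (proper_edge n) E ->
  trace_prod n (W_of E x zs) X =
  lsum (combine E zs) (fun p =>
    gvec x (fst (fst p)) * gvec x (snd (fst p)) * sg (snd p) *
    (X (fst (fst p)) (snd (fst p)) + X (snd (fst p)) (fst (fst p)))).
Proof.
  intros HE; revert zs; induction HE as [|[u w] E [Hu [Hw Huw]] HE IH]; intros zs.
  - apply rsum_0; intros; apply rsum_0; intros; unfold W_of; simpl; ring.
  - destruct zs as [|z zs].
    { apply rsum_0; intros; apply rsum_0; intros; unfold W_of; simpl; ring. }
    simpl in *; rewrite <- IH; unfold trace_prod.
    set (s := gvec x u * gvec x w * sg z).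
    replace (s * (X u w + X w u)) with
     (rsum n (fun i => bv u i * (s * rsum n (fun j => bv w j * X j i))) +
      rsum n (fun i => bv w i * (s * rsum n (fun j => bv u j * X j i)))).
    2:{ rewrite !rsum_bv by auto; ring. }
    rewrite <- !rsum_plus; apply rsum_ext; intros i Hi.
    rewrite <- !rsum_scal, <- !rsum_plus; apply rsum_ext; intros j Hj.
    unfold W_of; simpl; fold (W_of E x zs i j).
    change (fold_right _ 0 (combine E zs)) with (W_of E x zs i j).
    replace (if xorb (xorb (x u) (x w)) z then -1 else 1) with s
      by (unfold s, gvec, sg; destruct (x u), (x w), z; simpl; ring).
    unfold bv; rewrite (Nat.eqb_sym i u), (Nat.eqb_sym i w), (Nat.eqb_sym j u), (Nat.eqb_sym j w).
    destruct (Nat.eqb_spec u i), (Nat.eqb_spec w j), (Nat.eqb_spec u j), (Nat.eqb_spec w i);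
      simpl; try ring; exfalso; lia.
Qed.

Definition positive_off_constants (n : nat) (E : list (nat * nat)) (zs : list bool) : Prop :=
  forall v, rsum n v = 0 -> sqnorm n v <> 0 -> 0 < signed_laplacian E zs v.

Lemma signed_laplacian_ext n E zs v w : Forall (proper_edge n) E ->
  (forall i j, (i < n)%nat -> (j < n)%nat -> v i - v j = w i - w j) ->
  signed_laplacian E zs v = signed_laplacian E zs w.
Proof.
  intros HE H; apply lsum_ext; intros [e z] He; apply in_combine_l in He.
  rewrite Forall_forall in HE; destruct (HE e He) as [H1 [H2 _]].
  unfold sdiff; simpl; rewrite H; auto.
Qed.

(** Only differences of coordinates enter, so subtracting the mean reduces any [v] to the mean-zero
    case; a zero remainder means that [v] is constant. *)
Lemma signed_laplacian_kernel n E zs v :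
  Forall (proper_edge n) E -> positive_off_constants n E zs ->
  0 <= signed_laplacian E zs v /\
  (signed_laplacian E zs v = 0 -> forall i j, (i < n)%nat -> (j < n)%nat -> v i = v j).
Proof.
  intros HE pos; set (m := rsum n v / INR n); set (w := fun i => v i - m).
  assert (Hw : rsum n w = 0).
  { unfold w; rewrite rsum_minus, rsum_const; unfold m.
    destruct n; [simpl; ring|]; field; apply not_0_INR; lia. }
  assert (E1 : signed_laplacian E zs v = signed_laplacian E zs w).
  { apply (signed_laplacian_ext n); auto; intros; unfold w; ring. }
  destruct (Req_dec (sqnorm n w) 0) as [Z|Z].
  - assert (W0 : forall i, (i < n)%nat -> v i = m).
    { intros i Hi; assert (w i * w i = 0).
      { apply (rsum_nonneg_eq0 n (fun i => w i * w i)); auto; intros; nra. }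
      unfold w in *; nra. }
    split; [|intros; rewrite !W0; auto].
    rewrite (signed_laplacian_ext n E zs v (fun _ => 0)); auto.
    + unfold signed_laplacian, sdiff; rewrite (lsum_ext _ _ (fun _ => 0 * 0)) by (intros; ring).
      rewrite lsum_scal; lra.
    + intros; rewrite !W0 by auto; ring.
  - specialize (pos w Hw Z); rewrite E1; split; lra.
Qed.

Lemma gvec_sq x i : gvec x i * gvec x i = 1.
Proof. unfold gvec; destruct (x i); ring. Qed.

Lemma certificate_unique_opt n E zs x :
  Forall (proper_edge n) E -> positive_off_constants n E zs ->
  sdp_unique_opt n (W_of E x zs) (fun i j => gvec x i * gvec x j).
Proof.
  intros HE pos; split.
  - split; [intros; ring|split; [|intros; apply gvec_sq]].
    intros v; replace (quad n (fun i j => gvec x i * gvec x j) v)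
      with (ip n (gvec x) v * ip n (gvec x) v); [nra|].
    unfold quad, ip; rewrite <- rsum_scal_r; apply rsum_ext; intros.
    rewrite <- rsum_scal; apply rsum_ext; intros; ring.
  - intros X [Xs [Xp X1]].
    destruct (psd_gram n X (conj Xs Xp)) as [y Hy].
    (* Gram vectors with the signs of [g] absorbed: for [X = g g^T] they would all coincide, so the
       Laplacian measures the departure from the planted solution. *)
    set (w := fun k i => gvec x i * y k i).
    assert (Hw : forall i j, (i < n)%nat -> (j < n)%nat ->
      gvec x i * gvec x j * X i j = rsum n (fun k => w k i * w k j)).
    { intros i j Hi Hj; rewrite (Hy i j), <- rsum_scal by auto.
      apply rsum_ext; intros; unfold w; ring. }
    assert (Hw1 : forall i, (i < n)%nat -> rsum n (fun k => w k i * w k i) = 1).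
    { intros i Hi; rewrite <- Hw, gvec_sq, X1 by auto; ring. }
    (* Unit diagonals give [|w_u - w_v|^2 = 2 - 2 g_u g_v X_uv], so the optimality gap is the signed
       Laplacian summed over the coordinates of the Gram vectors. *)
    assert (G : trace_prod n (W_of E x zs) (fun i j => gvec x i * gvec x j) -
                trace_prod n (W_of E x zs) X =
                rsum n (fun k => signed_laplacian E zs (w k))).
    { unfold signed_laplacian; rewrite <- (lsum_rsum (combine E zs) n
        (fun p k => sg (snd p) * sdiff (w k) (fst p))).
      rewrite !trace_W_of by auto.
      match goal with |- ?a - lsum ?l ?f = _ =>
        replace (a - lsum l f) with (a + (-1) * lsum l f) by ring end.
      rewrite <- lsum_scal, <- lsum_plus; apply lsum_ext; intros [[u v] z] He.
      apply in_combine_l in He; rewrite Forall_forall in HE.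
      destruct (HE _ He) as [Hu [Hv _]]; simpl in *.
      rewrite rsum_scal; unfold sdiff; simpl.
      rewrite (rsum_ext n _ (fun k => w k u * w k u + w k v * w k v + (-2) * (w k u * w k v)))
        by (intros; ring).
      rewrite !rsum_plus, rsum_scal, !Hw1, <- Hw by auto.
      rewrite (Xs v u) by auto.
      assert (Gu := gvec_sq x u); assert (Gv := gvec_sq x v).
      replace (gvec x u * gvec x v * sg z * (gvec x u * gvec x v + gvec x v * gvec x u))
        with (sg z * 2 * ((gvec x u * gvec x u) * (gvec x v * gvec x v))) by ring.
      rewrite Gu, Gv; ring. }
    assert (P : forall k, (k < n)%nat -> 0 <= signed_laplacian E zs (w k))
      by (intros; apply (signed_laplacian_kernel n); auto).
    split; [assert (0 <= rsum n (fun k => signed_laplacian E zs (w k))) by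
      (apply rsum_nonneg; auto); lra|].
    intros Heq i j Hi Hj.
    assert (Z := rsum_nonneg_eq0 n _ P ltac:(lra)).
    (* A zero gap makes every coordinate constant across the vertices, so the unit vectors at [i]
       and [j] agree. *)
    assert (C : gvec x i * gvec x j * X i j = 1).
    { rewrite Hw, <- (Hw1 i) by auto; apply rsum_ext; intros k Hk.
      rewrite (proj2 (signed_laplacian_kernel n E zs (w k) HE pos) (Z k Hk) i j); auto. }
    replace (X i j) with ((gvec x i * gvec x i) * (gvec x j * gvec x j) * X i j)
      by (rewrite !gvec_sq; ring).
    replace (gvec x i * gvec x i * (gvec x j * gvec x j) * X i j)
      with (gvec x i * gvec x j * (gvec x i * gvec x j * X i j)) by ring.
    rewrite C; ring.
Qed.

(** * Laplacian of a regular graph *)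

Lemma lsum_seq n f : lsum (seq 0 n) f = rsum n f.
Proof.
  induction n as [|n IH]; [reflexivity|].
  rewrite seq_S, lsum_app, IH; simpl; ring.
Qed.

Lemma lsum_filter {A} (b : A -> bool) l f :
  lsum (filter b l) f = lsum l (fun a => if b a then f a else 0).
Proof. induction l as [|c l IH]; simpl; [reflexivity|]; destruct (b c); simpl; rewrite IH; ring. Qed.

Lemma lsum_list_prod {A B} (l : list A) (m : list B) f :
  lsum (list_prod l m) f = lsum l (fun a => lsum m (fun b => f (a, b))).
Proof. induction l as [|c l IH]; simpl; [reflexivity|]; rewrite lsum_app, lsum_map, IH; reflexivity. Qed.

Lemma edges_proper n a : Forall (proper_edge n) (edges n a).
Proof.
  apply Forall_forall; intros [u v] H; unfold edges in H.
  apply filter_In in H as [H1 H2]; apply in_prod_iff in H1 as [H3 H4].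
  apply in_seq in H3; apply in_seq in H4; simpl in *.
  apply andb_prop in H2 as [H2 _]; apply Nat.ltb_lt in H2.
  repeat split; simpl; lia.
Qed.

Lemma length_filter_lsum {A} (b : A -> bool) l :
  INR (length (filter b l)) = lsum l (fun a => if b a then 1 else 0).
Proof.
  induction l as [|c l IH]; [reflexivity|].
  simpl filter; simpl lsum; rewrite <- IH.
  destruct (b c); [change (length (c :: filter b l)) with (S (length (filter b l))); rewrite S_INR|]; ring.
Qed.

(** By symmetry the sum over [i < j] is half of the sum over ordered pairs, where each square
    [v_i^2] is weighted by a row sum, which is [d] by regularity. *)
Lemma edges_sdiff n d a v : simple_regular n d a ->
  lsum (edges n a) (sdiff v) = INR d * sqnorm n v - quad n (adjR a) v.
Proof.
  intros [Hs [Hd [_ Hr]]].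
  set (T := rsum n (fun i => rsum n (fun j =>
      if andb (Nat.ltb i j) (a i j) then sdiff v (i, j) else 0))).
  assert (ET : lsum (edges n a) (sdiff v) = T).
  { unfold edges; rewrite lsum_filter, lsum_list_prod, lsum_seq.
    apply rsum_ext; intros; rewrite lsum_seq; reflexivity. }
  assert (ET' : T = rsum n (fun i => rsum n (fun j =>
      if andb (Nat.ltb j i) (a i j) then sdiff v (i, j) else 0))).
  { unfold T; rewrite rsum_swap; apply rsum_ext; intros j _; apply rsum_ext; intros i _.
    rewrite (Hs i j); destruct (andb (Nat.ltb i j) (a j i)); unfold sdiff; simpl; ring. }
  assert (D : T + T = rsum n (fun i => rsum n (fun j =>
      v i * v i * adjR a i j + v j * v j * adjR a j i + (-2) * (v i * adjR a i j * v j)))).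
  { rewrite ET' at 2; unfold T; rewrite <- rsum_plus; apply rsum_ext; intros i _.
    rewrite <- rsum_plus; apply rsum_ext; intros j _; unfold adjR, sdiff; simpl; rewrite (Hs j i).
    destruct (a i j) eqn:Ea.
    - destruct (Nat.ltb_spec i j), (Nat.ltb_spec j i); simpl; try lia; try ring.
      assert (i = j) by lia; subst; congruence.
    - destruct (Nat.ltb i j), (Nat.ltb j i); simpl; ring. }
  assert (Rg : forall i, (i < n)%nat -> rsum n (fun j => adjR a i j) = INR d).
  { intros i Hi; rewrite <- (Hr i Hi), length_filter_lsum, lsum_seq; reflexivity. }
  assert (S1 : rsum n (fun i => rsum n (fun j => v i * v i * adjR a i j)) = INR d * sqnorm n v).
  { unfold sqnorm; rewrite <- rsum_scal; apply rsum_ext; intros i Hi.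
    rewrite rsum_scal, Rg by auto; ring. }
  rewrite ET.
  rewrite (rsum_ext n _ (fun i => rsum n (fun j => v i * v i * adjR a i j) +
     rsum n (fun j => v j * v j * adjR a j i) + (-2) * rsum n (fun j => v i * adjR a i j * v j))) in D.
  2:{ intros; rewrite <- rsum_scal, <- !rsum_plus; reflexivity. }
  rewrite !rsum_plus, rsum_scal, (rsum_swap n n (fun i j => v j * v j * adjR a j i)), S1 in D.
  unfold quad; lra.
Qed.

(** * Concentration *)

(** Half of the edge Laplacian is [u u^T] for this unit vector; the normalization is what the bound
    [f'' <= f'] asks for. *)
Definition uedge (e : nat * nat) (i : nat) : R := (bv (fst e) i - bv (snd e) i) / sqrt 2.

Lemma uedge_ip n e v : proper_edge n e -> ip n (uedge e) v * ip n (uedge e) v = sdiff v e / 2.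
Proof.
  intros [H1 [H2 _]].
  assert (S0 : sqrt 2 <> 0) by (apply Rgt_not_eq, sqrt_lt_R0; lra).
  assert (E : ip n (uedge e) v = / sqrt 2 * (v (fst e) - v (snd e))).
  { rewrite <- (ip_bv n (fst e) v), <- (ip_bv n (snd e) v) by auto.
    unfold ip; rewrite <- rsum_minus, <- rsum_scal; apply rsum_ext; intros.
    unfold uedge; field; auto. }
  rewrite E; unfold sdiff.
  match goal with |- ?l = _ => replace l with
    ((v (fst e) - v (snd e)) * (v (fst e) - v (snd e)) / (sqrt 2 * sqrt 2)) by (field; auto) end.
  rewrite sqrt_sqrt by lra; reflexivity.
Qed.

Lemma uedge_norm n e : proper_edge n e -> sqnorm n (uedge e) = 1.
Proof.
  intros [H1 [H2 H3]].
  assert (S0 : sqrt 2 <> 0) by (apply Rgt_not_eq, sqrt_lt_R0; lra).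
  unfold sqnorm.
  rewrite (rsum_ext n _ (fun i => / (sqrt 2 * sqrt 2) *
     (bv (fst e) i * (bv (fst e) i - bv (snd e) i) +
      (-1) * (bv (snd e) i * (bv (fst e) i - bv (snd e) i))))).
  2:{ intros; unfold uedge; field; auto. }
  rewrite rsum_scal, rsum_plus, rsum_scal.
  rewrite (rsum_bv n (fst e) (fun i => bv (fst e) i - bv (snd e) i)) by auto.
  rewrite (rsum_bv n (snd e) (fun i => bv (fst e) i - bv (snd e) i)) by auto.
  rewrite sqrt_sqrt by lra; unfold bv; rewrite !Nat.eqb_refl.
  destruct (Nat.eqb_spec (fst e) (snd e)), (Nat.eqb_spec (snd e) (fst e)); try lia; field.
Qed.

(** Coefficients travel with the edges, so that the random noise and its averaged replacement are
    instances of one construction. *)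
Definition add_edges (M : nat -> nat -> R) (l : list ((nat * nat) * R)) (i j : nat) : R :=
  M i j + lsum l (fun p => snd p * (uedge (fst p) i * uedge (fst p) j)).

Lemma add_edges_cons M e c l i j :
  add_edges M ((e, c) :: l) i j = rank1 (add_edges M l) (uedge e) c i j.
Proof. unfold add_edges, rank1; simpl; ring. Qed.

Lemma quad_ext n M M' v :
  (forall i j, (i < n)%nat -> (j < n)%nat -> M i j = M' i j) -> quad n M v = quad n M' v.
Proof. intros H; apply rsum_ext; intros; apply rsum_ext; intros; rewrite H; auto. Qed.

Lemma psd_ext n M M' :
  (forall i j, (i < n)%nat -> (j < n)%nat -> M i j = M' i j) -> psd n M -> psd n M'.
Proof.
  intros H [Hs Hp]; split.
  - intros i j Hi Hj; rewrite <- !H; auto.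
  - intros v; rewrite <- (quad_ext n M M'); auto.
Qed.

Lemma quad_add_edges n M l v : Forall (proper_edge n) (map fst l) ->
  quad n (add_edges M l) v = quad n M v + lsum l (fun p => snd p * (sdiff v (fst p) / 2)).
Proof.
  induction l as [|[e c] l IH]; intros H.
  - simpl; rewrite Rplus_0_r; apply quad_ext; intros; unfold add_edges; simpl; ring.
  - inversion H as [|? ? He Hl]; subst.
    rewrite (quad_ext n _ _ v (fun i j _ _ => add_edges_cons M e c l i j)).
    rewrite quad_rank1, IH, uedge_ip by auto; simpl; ring.
Qed.

Lemma sym_add_edges n M l : sym n M -> sym n (add_edges M l).
Proof.
  intros H i j Hi Hj; unfold add_edges; rewrite (H i j) by auto; f_equal.
  apply lsum_ext; intros; ring.
Qed.

Lemma psd_add_edges n M l : psd n M -> Forall (fun p => 0 <= snd p) l -> psd n (add_edges M l).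
Proof.
  intros HM H; induction H as [|[e c] l Hc Hl IH].
  - apply psd_ext with M; auto; intros; unfold add_edges; simpl; ring.
  - apply psd_ext with (rank1 (add_edges M l) (uedge e) c).
    + intros; symmetry; apply add_edges_cons.
    + apply psd_rank1; auto.
Qed.

Definition noise (k : R) (E : list (nat * nat)) (zs : list bool) : list ((nat * nat) * R) :=
  map (fun p => (fst p, if snd p : bool then k else 0)) (combine E zs).

Lemma noise_nonneg k E zs : 0 <= k -> Forall (fun p => 0 <= snd p) (noise k E zs).
Proof.
  intros Hk; apply Forall_forall; intros p Hp; unfold noise in Hp.
  apply in_map_iff in Hp as [[e z] [<- _]]; simpl; destruct z; lra.
Qed.

Lemma ln_mgf_nonneg p k : 0 < p < 1 -> 0 <= k -> 0 <= ln (1 - p + p * exp k).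
Proof.
  intros Hp Hk; assert (L := exp_ineq1_le k).
  destruct (Req_dec (1 - p + p * exp k) 1) as [->|]; [rewrite ln_1; lra|].
  left; rewrite <- ln_1; apply ln_increasing; nra.
Qed.

(* Replaces the Golden-Thompson/Lieb step of the matrix Laplace transform method. *)
Lemma expected_texp_le n K p k E : Forall (proper_edge n) E -> 0 < p < 1 -> 0 <= k ->
  forall M, psd n M ->
  lsum (blists (length E)) (fun zs => weight p zs * texp n (S K) (add_edges M (noise k E zs)))
  <= texp n (S K) (add_edges M (map (fun e => (e, ln (1 - p + p * exp k))) E)).
Proof.
  intros HE Hp Hk; induction HE as [|e E He HE IH]; intros M HM.
  - simpl; unfold noise; simpl; lra.
  - set (c := ln (1 - p + p * exp k)) in *.
    assert (Hc : 0 <= c) by (apply ln_mgf_nonneg; auto).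
    assert (Hu := uedge_norm n e He).
    simpl length; simpl blists; rewrite lsum_app, !lsum_map.
    set (N := add_edges M (map (fun e => (e, c)) E)).
    assert (HN : psd n N).
    { apply psd_add_edges; auto; apply Forall_forall; intros q Hq.
      apply in_map_iff in Hq as [e' [<- _]]; auto. }
    (* The realized coefficient of the first edge is absorbed into the base matrix, which is why the
       induction keeps [M] arbitrary. *)
    assert (EN : forall q l, texp n (S K) (add_edges M ((e, q) :: l)) =
                 texp n (S K) (add_edges (rank1 M (uedge e) q) l)).
    { intros; apply texp_ext; intros; unfold add_edges, rank1; simpl; ring. }
    assert (EN' : forall q, texp n (S K) (add_edges (rank1 M (uedge e) q) (map (fun e => (e, c)) E)) =
                 texp n (S K) (rank1 N (uedge e) q)).
    { intros; apply texp_ext; intros; unfold N, add_edges, rank1; ring. }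
    assert (B : forall q, 0 <= q ->
      lsum (blists (length E)) (fun zs => weight p zs *
         texp n (S K) (add_edges M ((e, q) :: noise k E zs)))
      <= texp n (S K) (rank1 N (uedge e) q)).
    { intros q Hq; rewrite <- EN'.
      rewrite (lsum_ext _ _ (fun zs => weight p zs *
         texp n (S K) (add_edges (rank1 M (uedge e) q) (noise k E zs))))
        by (intros; rewrite EN; reflexivity).
      apply IH, psd_rank1; auto. }
    simpl map; rewrite EN, EN'.
    apply Rle_trans with (2 := texp_rank1_concave n K N (uedge e) p k HN Hu Hp Hk).
    apply Rplus_le_compat.
    + rewrite (lsum_ext _ _ (fun zs => p * (weight p zs *
         texp n (S K) (add_edges M ((e, k) :: noise k E zs)))))
        by (intros; simpl; unfold noise; simpl; ring).
      rewrite lsum_scal; apply Rmult_le_compat_l; [lra|]; apply B; lra.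
    + rewrite (lsum_ext _ _ (fun zs => (1 - p) * (weight p zs *
         texp n (S K) (add_edges M ((e, 0) :: noise k E zs)))))
        by (intros; simpl; unfold noise; simpl; ring).
      rewrite lsum_scal; apply Rmult_le_compat_l; [lra|]; apply B; lra.
Qed.

(** * Noise patterns as a probability space, and the Laplace transform bound *)

Lemma weight_nonneg p zs : 0 <= p <= 1 -> 0 <= weight p zs.
Proof.
  intros Hp; induction zs as [|z zs IH]; simpl; [lra|].
  apply Rmult_le_pos; auto; destruct z; lra.
Qed.

Lemma weight_total p m : lsum (blists m) (weight p) = 1.
Proof.
  induction m as [|m IH]; [simpl; ring|].
  simpl; rewrite lsum_app, !lsum_map.
  rewrite (lsum_ext _ _ (fun zs => p * weight p zs)) by reflexivity.
  rewrite (lsum_ext _ (fun zs => weight p (false :: zs)) (fun zs => (1 - p) * weight p zs))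
    by reflexivity.
  rewrite !lsum_scal, IH; ring.
Qed.

Lemma blists_length m zs : In zs (blists m) -> length zs = m.
Proof.
  revert zs; induction m as [|m IH]; simpl; intros zs H.
  - destruct H as [<-|[]]; reflexivity.
  - apply in_app_iff in H as [H|H]; apply in_map_iff in H as [zs' [<- H]]; simpl; auto.
Qed.

Lemma prob_markov n a p (P : list bool -> Prop) (G : list bool -> R) Y : 0 <= p <= 1 ->
  (forall zs, 0 <= G zs) ->
  (forall zs, length zs = length (edges n a) -> ~ P zs -> Y <= G zs) ->
  (1 - prob n a p P) * Y <= lsum (blists (length (edges n a))) (fun zs => weight p zs * G zs).
Proof.
  intros Hp G0 H; rewrite <- (weight_total p (length (edges n a))).
  set (m := length (edges n a)) in *.
  change (prob n a p P) with (lsum (blists m) (fun zs =>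
    if excluded_middle_informative (P zs) then weight p zs else 0)).
  match goal with |- (?x - ?y) * Y <= _ => replace ((x - y) * Y) with (Y * (x + (-1) * y)) by ring end.
  rewrite <- lsum_scal, <- lsum_plus, <- lsum_scal; apply lsum_le; intros zs Hz.
  apply blists_length in Hz; assert (W := weight_nonneg p zs Hp); specialize (G0 zs).
  destruct (excluded_middle_informative (P zs)) as [HP|HP]; [nra|].
  specialize (H zs Hz HP); nra.
Qed.

Lemma lsum_combine_fst {A B} (E : list A) (zs : list B) f : length zs = length E ->
  lsum (combine E zs) (fun p => f (fst p)) = lsum E f.
Proof.
  revert zs; induction E as [|e E IH]; intros [|z zs] H; simpl in *; try lia; try reflexivity.
  rewrite IH; auto.
Qed.

Lemma tr_nonneg n M k : psd n M -> 0 <= tr n M k.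
Proof. intros; apply rsum_nonneg; intros; apply mom_nonneg; auto. Qed.

Lemma texp_nonneg n K M : psd n M -> 0 <= texp n K M.
Proof.
  intros; apply rsum_nonneg; intros; apply Rmult_le_pos; [apply tr_nonneg; auto|].
  left; apply Rinv_0_lt_compat, INR_fact_lt_0.
Qed.

Definition scalar_mx (s : R) (i j : nat) : R := if Nat.eqb i j then s else 0.

Lemma quad_scalar_mx n s v : quad n (scalar_mx s) v = s * sqnorm n v.
Proof.
  unfold quad, sqnorm; rewrite <- rsum_scal; apply rsum_ext; intros i Hi.
  rewrite (rsum_ext n _ (fun j => bv i j * (v i * s * v j))).
  - rewrite rsum_bv by auto; ring.
  - intros j _; unfold scalar_mx, bv; rewrite Nat.eqb_sym; destruct (Nat.eqb j i); ring.
Qed.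

(** If positivity fails at [v], the flipped edges carry at least half of the Laplacian form at [v];
    after centering by [p] and scaling by [k / 2], the excess is at least [k (1 - 2 p) / 4] times
    that form. *)
Lemma prob_positive_bound n a p k D D2 :
  let E := edges n a in
  0 < p < 1 / 2 -> 0 <= k -> 0 <= D -> 0 <= D2 ->
  (forall v, lsum E (sdiff v) <= D * sqnorm n v) ->
  (forall v, rsum n v = 0 -> D2 * sqnorm n v <= lsum E (sdiff v)) ->
  1 - prob n a p (positive_off_constants n E) <=
  INR n * exp ((ln (1 - p + p * exp k) - k * p) * (D / 2) - k * (1 - 2 * p) / 4 * D2).
Proof.
  intros E Hp Hk HD HD2 Hup Hlow.
  assert (HE : Forall (proper_edge n) E) by apply edges_proper.
  assert (HEm : forall c : R, Forall (proper_edge n) (map fst (map (fun e => (e, c)) E))).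
  { intros c; rewrite map_map, map_id; exact HE. }
  set (c := ln (1 - p + p * exp k)).
  assert (Hck : k * p <= c).
  { (* Jensen, as concavity of the identity in [exp c] *)
    assert (X := concave_in_exp (fun c => c) (fun _ => 1)); unfold c.
    specialize (X (fun c _ => derivable_pt_lim_id c)
      (fun c _ => ex_intro _ 0 (conj (derivable_pt_lim_const 1 c) Rle_0_1)) p k ltac:(lra) Hk).
    simpl in X; lra. }
  (* the shift [s] makes the deterministic part of the noise matrix semidefinite *)
  set (s := k * p * (D / 2)).
  assert (Hs : 0 <= s) by (unfold s; apply Rmult_le_pos; nra).
  set (B := add_edges (scalar_mx s) (map (fun e => (e, - (k * p))) E)).
  assert (QB : forall v, quad n B v = s * sqnorm n v - k * p * (lsum E (sdiff v) / 2)).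
  { intros v; unfold B; rewrite quad_add_edges, quad_scalar_mx, lsum_map by auto; simpl.
    rewrite lsum_scal; unfold Rdiv.
    rewrite (lsum_ext E _ (fun e => / 2 * sdiff v e)) by (intros; ring).
    rewrite lsum_scal; ring. }
  assert (HB : psd n B).
  { split.
    - apply sym_add_edges; intros i j _ _; unfold scalar_mx; rewrite Nat.eqb_sym; reflexivity.
    - intros v; rewrite QB; specialize (Hup v); unfold s; assert (0 <= k * p) by nra; nra. }
  (* [b] bounds the top eigenvalue of the averaged matrix, and [y] bounds from below the Rayleigh
     quotient at a vector violating positivity. Both contain [s], which cancels in [b - y]. *)
  set (b := s + (c - k * p) * (D / 2)).
  set (y := s + k * (1 - 2 * p) / 4 * D2).
  assert (Hy : 0 <= y).
  { unfold y; assert (0 <= k * (1 - 2 * p) / 4 * D2); [|lra].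
    apply Rmult_le_pos; [|auto]; assert (0 <= k * (1 - 2 * p)) by nra; lra. }
  assert (Hb : 0 <= b) by (unfold b; assert (0 <= (c - k * p) * (D / 2)) by nra; lra).
  set (q := 1 - prob n a p (positive_off_constants n E)).
  assert (Hc : 0 <= c) by (apply ln_mgf_nonneg; lra).
  assert (KB : forall K, q * rsum (S K) (fun k => y ^ k / INR (fact k)) <= INR n * exp b).
  { intros K.
    apply Rle_trans with (lsum (blists (length E)) (fun zs => weight p zs *
      texp n (S K) (add_edges B (noise k E zs)))).
    - apply prob_markov; [lra| |].
      + intros; apply texp_nonneg, psd_add_edges; auto; apply noise_nonneg; auto.
      + intros zs Hz Hn; fold E in Hz.
        apply not_all_ex_not in Hn as [v Hv].
        apply imply_to_and in Hv as [Hv1 Hv]; apply imply_to_and in Hv as [Hv2 Hv].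
        assert (Hv0 : 0 < sqnorm n v).
        { assert (0 <= sqnorm n v) by apply ip_self_nonneg; lra. }
        apply Rnot_lt_le in Hv.
        apply texp_lower with v; auto.
        * apply psd_add_edges; auto; apply noise_nonneg; auto.
        * rewrite quad_add_edges.
          2:{ unfold noise; rewrite map_map; apply Forall_forall; intros e He.
              apply in_map_iff in He as [[e' z] [<- He]]; apply in_combine_l in He.
              rewrite Forall_forall in HE; apply HE; auto. }
          rewrite QB; unfold noise; rewrite lsum_map; simpl.
          (* Writes the noise bit as [(1 - sg z) / 2]. *)
          rewrite (lsum_ext _ _ (fun x => k / 4 * sdiff v (fst x) +
              - (k / 4) * (sg (snd x) * sdiff v (fst x)))).
          2:{ intros [e z] _; simpl; unfold sg; destruct z; field. }
          rewrite lsum_plus, !lsum_scal.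
          rewrite (lsum_combine_fst E zs (sdiff v)) by auto.
          unfold signed_laplacian in Hv.
          set (L := lsum (combine E zs) _) in *.
          specialize (Hlow v Hv1); set (Q := lsum E (sdiff v)) in *.
          unfold y.
          assert (0 <= k * (1 - 2 * p) / 4).
          { assert (0 <= k * (1 - 2 * p)) by nra; lra. }
          assert (0 <= - (k / 4) * L) by nra.
          assert (k * (1 - 2 * p) / 4 * (D2 * sqnorm n v) <= k * (1 - 2 * p) / 4 * Q)
            by (apply Rmult_le_compat_l; auto).
          nra.
    - apply Rle_trans with (texp n (S K) (add_edges B (map (fun e => (e, c)) E))).
      + apply expected_texp_le; auto; lra.
      + apply texp_upper; auto.
        * apply psd_add_edges; auto; apply Forall_forall; intros e He.
          apply in_map_iff in He as [e' [<- _]]; simpl; auto.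
        * intros w; rewrite quad_add_edges, QB, lsum_map by auto; simpl.
          rewrite lsum_scal; unfold Rdiv at 2.
          rewrite (lsum_ext E (fun e => sdiff w e * / 2) (fun e => / 2 * sdiff w e)) by (intros; ring).
          rewrite lsum_scal; specialize (Hup w); unfold b.
          assert ((c - k * p) * lsum E (sdiff w) <= (c - k * p) * (D * sqnorm n w))
            by (apply Rmult_le_compat_l; lra).
          lra. }
  assert (Lim : q * exp y <= INR n * exp b).
  { apply (@Rle_cv_lim (fun K => q * rsum (S K) (fun k => y ^ k / INR (fact k)))
      (fun _ => INR n * exp b)); [exact KB| |].
    - apply (CV_mult (fun _ => q)); [|apply exp_partial_cv].
      intros e He; exists 0%nat; intros; unfold Rdist; rewrite Rminus_diag, Rabs_R0; auto.
    - intros e He; exists 0%nat; intros; unfold Rdist; rewrite Rminus_diag, Rabs_R0; auto. }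
  apply Rmult_le_reg_r with (exp y); [apply exp_pos|].
  rewrite Rmult_assoc, <- exp_plus.
  apply Rle_trans with (1 := Lim); right; f_equal; f_equal; unfold b, y; ring.
Qed.

(** * Bernstein's bound and the theorem *)

(** Multiplied by [1 - y / 3], the case [R0 = y] reads [q y >= 0], where [q] is convex with [q] and
    [q'] zero at [0]; the convexity is [1 - y <= exp (- y)]. Raising [y] to [R0] in the denominator
    only weakens the bound. *)
Lemma exp_bernstein y R0 : y <= R0 -> R0 < 3 -> exp y <= 1 + y + y * y / 2 / (1 - R0 / 3).
Proof.
  intros Hy HR.
  set (q := fun y => 1 + 2 / 3 * y + y * y / 6 - (1 - y / 3) * exp y).
  set (q1 := fun y => 2 / 3 + y / 3 - (2 / 3 - y / 3) * exp y).
  set (q2 := fun y => 1 / 3 * (1 - (1 - y) * exp y)).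
  assert (Daff : forall a b x, derivable_pt_lim (fun y => a + b * y) x b).
  { intros a b x; cut (derivable_pt_lim (fun y => a + b * y) x (0 + b * 1));
      [rewrite Rplus_0_l, Rmult_1_r; auto|].
    apply (derivable_pt_lim_plus (fun _ => a) (fun y => b * y)); [apply derivable_pt_lim_const|].
    apply (derivable_pt_lim_scal (fun y => y)), derivable_pt_lim_id. }
  assert (Daexp : forall a b x,
    derivable_pt_lim (fun y => (a + b * y) * exp y) x (b * exp x + (a + b * x) * exp x)).
  { intros; apply (derivable_pt_lim_mult (fun y => a + b * y) exp); auto.
    apply derivable_pt_lim_exp. }
  assert (D1 : forall x, derivable_pt_lim q1 x (q2 x)).
  { intros x; apply derivable_pt_lim_ext with
      (fun y => (2 / 3 + 1 / 3 * y) - (2 / 3 + (- (1 / 3)) * y) * exp y).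
    { intros; unfold q1; field. }
    replace (q2 x) with (1 / 3 - (- (1 / 3) * exp x + (2 / 3 + - (1 / 3) * x) * exp x))
      by (unfold q2; field).
    apply (derivable_pt_lim_minus (fun y => 2 / 3 + 1 / 3 * y)
       (fun y => (2 / 3 + (- (1 / 3)) * y) * exp y)); auto. }
  assert (D0 : forall x, derivable_pt_lim q x (q1 x)).
  { intros x; apply derivable_pt_lim_ext with
      (fun y => ((1 + 2 / 3 * y) + 1 / 6 * (y * y)) - (1 + (- (1 / 3)) * y) * exp y).
    { intros; unfold q; field. }
    replace (q1 x) with ((2 / 3 + 1 / 6 * (1 * x + x * 1)) -
       (- (1 / 3) * exp x + (1 + - (1 / 3) * x) * exp x)) by (unfold q1; field).
    apply (derivable_pt_lim_minus (fun y => (1 + 2 / 3 * y) + 1 / 6 * (y * y))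
       (fun y => (1 + (- (1 / 3)) * y) * exp y)); auto.
    apply (derivable_pt_lim_plus (fun y => 1 + 2 / 3 * y) (fun y => 1 / 6 * (y * y))); auto.
    apply (derivable_pt_lim_scal (fun y => y * y)).
    apply (derivable_pt_lim_mult (fun y => y) (fun y => y)); apply derivable_pt_lim_id. }
  assert (P2 : forall x, 0 <= q2 x).
  { intros x; unfold q2; assert (L := exp_ineq1_le (- x)); assert (X := exp_pos x).
    rewrite exp_Ropp in L.
    assert ((1 - x) * exp x <= / exp x * exp x) by (apply Rmult_le_compat_r; lra).
    rewrite Rinv_l in * by lra; lra. }
  assert (Z1 : q1 0 = 0) by (unfold q1; rewrite exp_0; field).
  assert (Z0 : q 0 = 0) by (unfold q; rewrite exp_0; field).
  assert (M1 : forall x z, x <= z -> q1 x <= q1 z).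
  { intros x z Hxz; apply Ropp_le_cancel.
    apply (nonincreasing_of_deriv (fun y => - q1 y) (fun y => - q2 y) x z Hxz).
    - intros; apply (derivable_pt_lim_opp q1); auto.
    - intros w _; specialize (P2 w); lra. }
  assert (Q : 0 <= q y).
  { destruct (Rle_lt_dec 0 y) as [H|H].
    - rewrite <- Z0; apply Ropp_le_cancel.
      apply (nonincreasing_of_deriv (fun y => - q y) (fun y => - q1 y) 0 y H).
      + intros; apply (derivable_pt_lim_opp q); auto.
      + intros w Hw; assert (q1 0 <= q1 w) by (apply M1; lra); lra.
    - rewrite <- Z0; apply (nonincreasing_of_deriv q q1 y 0); auto; [lra|].
      intros w Hw; rewrite <- Z1; apply M1; lra. }
  apply Rle_trans with (1 + y + y * y / 2 / (1 - y / 3)).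
  - apply Rmult_le_reg_r with (1 - y / 3); [lra|].
    replace ((1 + y + y * y / 2 / (1 - y / 3)) * (1 - y / 3))
      with (1 + 2 / 3 * y + y * y / 6) by (field; lra).
    unfold q in Q; lra.
  - apply Rplus_le_compat_l; unfold Rdiv at 1 3.
    apply Rmult_le_compat_l; [nra|]; apply Rinv_le_contravar; lra.
Qed.

(** The centered bit takes the values [1 - p] and [- p], both at most [1 - p]; averaging the scalar
    bound over them kills the linear term and leaves the variance [p (1 - p)]. *)
Lemma ln_mgf_bernstein p k : 0 < p < 1 -> 0 <= k -> k * (1 - p) < 3 ->
  ln (1 - p + p * exp k) - k * p <= p * (1 - p) * (k * k) / 2 / (1 - k * (1 - p) / 3).
Proof.
  intros Hp Hk HR; set (r := 1 - k * (1 - p) / 3).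
  assert (A := exp_bernstein (k * (1 - p)) (k * (1 - p)) ltac:(lra) HR).
  assert (B := exp_bernstein (- (k * p)) (k * (1 - p)) ltac:(nra) HR).
  fold r in A, B; assert (Hr : 0 < r) by (unfold r; lra).
  set (V := p * (1 - p) * (k * k) / 2 / r).
  assert (X : 0 < p * exp k) by (apply Rmult_lt_0_compat; [lra|apply exp_pos]).
  assert (C : (1 - p + p * exp k) * exp (- (k * p)) <= exp V).
  { apply Rle_trans with (1 + V); [|apply exp_ineq1_le].
    replace ((1 - p + p * exp k) * exp (- (k * p)))
      with ((1 - p) * exp (- (k * p)) + p * exp (k * (1 - p))).
    - assert (A' := Rmult_le_compat_l p _ _ ltac:(lra) A).
      assert (B' := Rmult_le_compat_l (1 - p) _ _ ltac:(lra) B).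
      apply Rle_trans with (1 := Rplus_le_compat _ _ _ _ B' A').
      right; unfold V; field; lra.
    - replace (k * (1 - p)) with (k + - (k * p)) by ring; rewrite exp_plus; ring. }
  apply Rnot_lt_le; intros F; apply Rle_not_lt in C; apply C.
  rewrite <- (exp_ln (1 - p + p * exp k)) by lra; rewrite <- exp_plus.
  apply exp_increasing; lra.
Qed.

Lemma exp_le_mono x y : x <= y -> exp x <= exp y.
Proof. intros [H|<-]; [left; apply exp_increasing; auto|right; reflexivity]. Qed.

Lemma prob_mono n a p (P Q : list bool -> Prop) : 0 <= p <= 1 ->
  (forall zs, P zs -> Q zs) -> prob n a p P <= prob n a p Q.
Proof.
  intros Hp H; apply lsum_le; intros zs _; assert (W := weight_nonneg p zs Hp).
  destruct (excluded_middle_informative (P zs)), (excluded_middle_informative (Q zs)); try lra.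
  exfalso; auto.
Qed.

(** Removing the mean leaves the edge sum unchanged and does not increase the norm; [-1 <= l] makes
    the factor nonnegative, so that this comparison of norms can be used. *)
Lemma laplacian_upper n d a l v : simple_regular n d a -> (0 < d)%nat ->
  is_abs_lambdan n d a l -> -1 <= l ->
  lsum (edges n a) (sdiff v) <= INR d * (1 + l) * sqnorm n v.
Proof.
  intros Hr Hd Hl Hl1.
  assert (Hd0 : 0 < INR d) by (apply lt_0_INR; auto).
  set (m := rsum n v / INR n); set (w := fun i => v i - m).
  assert (Hw : rsum n w = 0).
  { unfold w; rewrite rsum_minus, rsum_const; unfold m.
    destruct n; [simpl; ring|]; field; apply not_0_INR; lia. }
  assert (E1 : lsum (edges n a) (sdiff v) = lsum (edges n a) (sdiff w)).
  { apply lsum_ext; intros; unfold sdiff, w; ring. }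
  assert (N : sqnorm n w <= sqnorm n v).
  { assert (X : sqnorm n v = sqnorm n w + 2 * m * rsum n w + INR n * (m * m)).
    { unfold sqnorm; rewrite <- rsum_const, <- rsum_scal, <- !rsum_plus.
      apply rsum_ext; intros; unfold w; ring. }
    rewrite Hw in X; assert (0 <= INR n * (m * m)) by (apply Rmult_le_pos; [apply pos_INR|nra]); lra. }
  assert (0 <= INR d * (1 + l)) by (apply Rmult_le_pos; lra).
  apply Rle_trans with (INR d * (1 + l) * sqnorm n w); [|apply Rmult_le_compat_l; auto].
  rewrite E1, (edges_sdiff n d a w Hr).
  assert (N0 : 0 <= sqnorm n w) by apply ip_self_nonneg.
  destruct (Req_dec (sqnorm n w) 0) as [Z|Z].
  - assert (W0 : forall i, (i < n)%nat -> w i = 0).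
    { intros i Hi; assert (w i * w i = 0).
      { apply (rsum_nonneg_eq0 n (fun i => w i * w i)); auto; intros; nra. }
      nra. }
    assert (quad n (adjR a) w = 0).
    { apply rsum_0; intros; apply rsum_0; intros; rewrite (W0 i) by auto; ring. }
    rewrite Z; lra.
  - assert (B := proj2 Hl (- (/ INR d * (quad n (adjR a) w / sqnorm n w)))).
    simpl in B; rewrite Ropp_involutive in B.
    specialize (B (ex_intro _ w (conj Hw (conj Z eq_refl)))).
    assert (B' := Rmult_le_compat_l (INR d * sqnorm n w) _ _ ltac:(nra) B).
    replace (INR d * sqnorm n w * - (/ INR d * (quad n (adjR a) w / sqnorm n w)))
      with (- quad n (adjR a) w) in B' by (field; lra).
    lra.
Qed.

Lemma laplacian_lower n d a l v : simple_regular n d a -> (0 < d)%nat ->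
  is_lambda2 n d a l -> rsum n v = 0 ->
  INR d * (1 - l) * sqnorm n v <= lsum (edges n a) (sdiff v).
Proof.
  intros Hr Hd Hl Hv; assert (Hd0 : 0 < INR d) by (apply lt_0_INR; auto).
  rewrite (edges_sdiff n d a v Hr).
  assert (N0 : 0 <= sqnorm n v) by apply ip_self_nonneg.
  destruct (Req_dec (sqnorm n v) 0) as [Z|Z].
  - assert (W0 : forall i, (i < n)%nat -> v i = 0).
    { intros i Hi; assert (v i * v i = 0).
      { apply (rsum_nonneg_eq0 n (fun i => v i * v i)); auto; intros; nra. }
      nra. }
    assert (quad n (adjR a) v = 0).
    { apply rsum_0; intros; apply rsum_0; intros; rewrite (W0 i) by auto; ring. }
    rewrite Z; lra.
  - assert (B := proj2 Hl _ (ex_intro _ v (conj Hv (conj Z eq_refl)))); simpl in B.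
    assert (B' := Rmult_le_compat_l (INR d * sqnorm n v) _ _ ltac:(nra) B).
    replace (INR d * sqnorm n v * (/ INR d * (quad n (adjR a) v / sqnorm n v)))
      with (quad n (adjR a) v) in B' by (field; lra).
    lra.
Qed.

(** Serves to make [ln (INR n)] positive: a nonzero vector of zero sum has at least two
    coordinates. *)
Lemma rayleigh_set_size n d a r : rayleigh_set n d a r -> (2 <= n)%nat.
Proof.
  intros [v [Hv [Hn _]]]; destruct n as [|[|n]]; [| |lia]; exfalso; apply Hn; unfold sqnorm in *;
    simpl in *; nra.
Qed.

Theorem theorem5 (n d : nat) (a : nat -> nat -> bool) (x : nat -> bool)
  (lam2 lamn_abs eps delta : R) :
  simple_regular n d a ->
  is_lambda2 n d a lam2 ->
  is_abs_lambdan n d a lamn_abs ->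
  lam2 < 1 ->
  0 < eps < 1 / 2 ->
  0 < delta ->
  INR d / ln (INR n) >=
    4 * (1 + lamn_abs) / (1 - lam2) ^ 2 * (1 + delta) *
    (1 / (1 - 2 * eps) ^ 2
     + 1 / 3 * (1 - lam2) / ((1 - 2 * eps) * (1 + lamn_abs))
     + 1 / 3 * (1 - lam2) / (1 + lamn_abs) - 1) ->
  prob n a eps
    (fun zs => sdp_unique_opt n (W_of (edges n a) x zs)
                 (fun i j => gvec x i * gvec x j))
  >= 1 - Rpower (INR n) (- delta).
Proof.
  intros Hr H2 Hn Hl He Hdl Hcond.
  assert (Hn2 : (2 <= n)%nat) by (apply (rayleigh_set_size n d a lam2), H2).
  assert (Hln : 0 < ln (INR n)).
  { rewrite <- ln_1; apply ln_increasing; [lra|]; apply (lt_INR 1); lia. }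
  (* The vector attaining [lam2] also competes for [lamn_abs], with its quotient negated. *)
  assert (Hlam : 0 < 1 + lamn_abs).
  { assert (- lam2 <= lamn_abs); [|lra].
    apply (proj2 Hn); simpl; rewrite Ropp_involutive; apply H2. }
  (* Bernstein's denominator per unit of degree, at deviation [t]: the fluctuation
     [2 (Z_e - eps) L_e] has mean square [8 eps (1 - eps) L_e] and norm at most [4 (1 - eps)]. *)
  set (S := 8 * eps * (1 - eps) * (1 + lamn_abs) +
            4 * (1 - eps) / 3 * ((1 - 2 * eps) * (1 - lam2))).
  set (t := (1 - 2 * eps) * (1 - lam2)).
  assert (Ht : 0 < t) by (unfold t; apply Rmult_lt_0_compat; lra).
  assert (Hee : 0 < eps * (1 - eps)) by nra.
  assert (HV : 0 < 8 * eps * (1 - eps) * (1 + lamn_abs)).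
  { replace (8 * eps * (1 - eps)) with (8 * (eps * (1 - eps))) by ring.
    apply Rmult_lt_0_compat; lra. }
  assert (HRt : 0 < 4 * (1 - eps) / 3 * t) by (apply Rmult_lt_0_compat; lra).
  assert (HS : 0 < S) by (unfold S; fold t; lra).
  (* The bracket in the hypothesis comes from [4 eps (1 - eps) = 1 - (1 - 2 eps)^2] and
     [2 (1 - eps) = 1 + (1 - 2 eps)]. *)
  match type of Hcond with _ >= ?rhs =>
    replace rhs with ((1 + delta) * (2 * S / (t * t))) in Hcond
  end.
  2:{ unfold S, t; field; repeat split; lra. }
  assert (HX : 0 < 2 * S / (t * t)) by (apply Rdiv_lt_0_compat; nra).
  assert (Hd : 0 < INR d).
  { assert (P : 0 < INR d / ln (INR n)) by nra.
    apply Rmult_lt_reg_r with (/ ln (INR n)); [apply Rinv_0_lt_compat; auto|].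
    unfold Rdiv in P; lra. }
  assert (Hdn : (0 < d)%nat) by (apply INR_lt; simpl; auto).
  assert (Hexp : (1 + delta) * ln (INR n) <= INR d * (t * t) / (2 * S)).
  { apply Rge_le in Hcond.
    assert (C := Rmult_le_compat_r (ln (INR n) * (t * t / (2 * S))) _ _
      ltac:(apply Rmult_le_pos; [lra|left; apply Rdiv_lt_0_compat; nra]) Hcond).
    replace ((1 + delta) * (2 * S / (t * t)) * (ln (INR n) * (t * t / (2 * S))))
      with ((1 + delta) * ln (INR n)) in C by (field; lra).
    replace (INR d / ln (INR n) * (ln (INR n) * (t * t / (2 * S))))
      with (INR d * (t * t) / (2 * S)) in C by (field; lra).
    exact C. }
  (* [k / 4] is the optimal parameter of the Laplace transform bound *)
  set (k := 4 * (t / S)).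
  assert (Hk : 0 < k) by (unfold k; assert (0 < t / S) by (apply Rdiv_lt_0_compat; auto); lra).
  (* With this [k] the Bernstein correction is exactly the variance share of [S], so the
     denominators cancel in the exponent. *)
  assert (Hk3 : 1 - k * (1 - eps) / 3 = 8 * eps * (1 - eps) * (1 + lamn_abs) / S).
  { unfold k; apply Rmult_eq_reg_r with S; [|lra].
    replace ((1 - 4 * (t / S) * (1 - eps) / 3) * S)
      with (S - 4 * (1 - eps) / 3 * t) by (field; lra).
    unfold Rdiv at 2; rewrite Rmult_assoc, Rinv_l by lra; unfold S; fold t; ring. }
  assert (Hk3' : 0 < 1 - k * (1 - eps) / 3) by (rewrite Hk3; apply Rdiv_lt_0_compat; auto).
  assert (Bd := prob_positive_bound n a eps k (INR d * (1 + lamn_abs)) (INR d * (1 - lam2))).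
  simpl in Bd.
  specialize (Bd He ltac:(lra) ltac:(nra) ltac:(nra)).
  specialize (Bd (fun v => laplacian_upper n d a lamn_abs v Hr Hdn Hn ltac:(lra))
                 (fun v => laplacian_lower n d a lam2 v Hr Hdn H2)).
  assert (Br := ln_mgf_bernstein eps k ltac:(lra) ltac:(lra) ltac:(lra)).
  rewrite Hk3 in Br.
  assert (Fin : INR n * exp ((ln (1 - eps + eps * exp k) - k * eps) * (INR d * (1 + lamn_abs) / 2) -
       k * (1 - 2 * eps) / 4 * (INR d * (1 - lam2))) <= Rpower (INR n) (- delta)).
  { assert (Hn0 : 0 < INR n) by (apply lt_0_INR; lia).
    rewrite <- (exp_ln (INR n)) at 1 by auto; rewrite <- exp_plus; unfold Rpower.
    apply exp_le_mono.
    assert (Br' := Rmult_le_compat_r (INR d * (1 + lamn_abs) / 2) _ _ ltac:(nra) Br).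
    (* The spectral gap term is twice the variance bound, so the exponent is at most
       [ln n - d t^2 / (2 S)]; the hypothesis leaves [- delta ln n] once the dimension factor is
       paid. *)
    replace (k * (1 - 2 * eps) / 4 * (INR d * (1 - lam2))) with (2 * (INR d * (t * t) / (2 * S)))
      by (unfold k, t; field; lra).
    replace (eps * (1 - eps) * (k * k) / 2 / (8 * eps * (1 - eps) * (1 + lamn_abs) / S) *
        (INR d * (1 + lamn_abs) / 2)) with (INR d * (t * t) / (2 * S)) in Br'
      by (unfold k; field; repeat split; lra).
    lra. }
  assert (Mono := prob_mono n a eps (positive_off_constants n (edges n a))
    (fun zs => sdp_unique_opt n (W_of (edges n a) x zs) (fun i j => gvec x i * gvec x j))
    ltac:(lra) (fun zs => certificate_unique_opt n (edges n a) zs x (edges_proper n a))).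
  lra.
Qed.
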